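(* Let $p$ be an odd prime, let $G$ be a proper multiplicative subgroup of $\mathbb{F}_p$, and let $\lambda\in\mathbb{F}_p^*\setminus G$. Suppose that $A,B\subseteq\mathbb{F}_p^*$ satisfy $|A|\ge 2$, $|B|\ge 2$, $AB=G-\lambda$ and $|A||B|=|G|+\min\{|A|,|B|\}-1$. Then \[ p=11,\qquad G=\mathcal{R}_{11},\qquad\text{and}\qquad \{|A|,|B|\}=\{2,3\}. \] In particular, if $p\neq 11$, then there do not exist subsets $A,B\subseteq\mathbb{F}_p^*$ with $|A|,|B|\ge 2$ and $|A||B|=|G|+\min\{|A|,|B|\}-1$ such that $AB=G-\lambda$.
   Context: $\mathbb{F}_p$ is the finite field with $p$ elements and $\mathbb{F}_p^*=\mathbb{F}_p\setminus\{0\}$. A proper multiplicative subgroup $G$ of $\mathbb{F}_p$ means a proper subgroup of the multiplicative group $\mathbb{F}_p^*$. For subsets $A,B\subseteq\mathbb{F}_p$, $AB=\{ab: a\in A,\ b\in B\}$ is the product set, and $G-\lambda=\{g-\lambda: g\in G\}$. $\mathcal{R}_p$ denotes the set of nonzero squares in $\mathbb{F}_p$; so $\mathcal{R}_{11}=\{1,3,4,5,9\}\subseteq\mathbb{F}_{11}$. *)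

(* Defs.v *)
From HB Require Import structures.
From mathcomp Require Import all_boot all_order all_algebra all_fingroup.

Set Implicit Arguments.
Unset Strict Implicit.
Unset Printing Implicit Defensive.

Import GRing.Theory.
Local Open Scope ring_scope.

(* 'F_p is the field with p elements only for p prime; every use below is
   meant under that hypothesis. *)

Definition nonzero (p : nat) : {set 'F_p} := [set x | x != 0].

(* A multiplicative subgroup of 'F_p is a group of units; this is the
   underlying subset of the field. *)
Definition elements (p : nat) (G : {group {unit 'F_p}}) : {set 'F_p} :=
  [set val u | u in G].

Definition prodset (p : nat) (A B : {set 'F_p}) : {set 'F_p} :=
  [set a * b | a in A, b in B].

Definition translate_sub (p : nat) (S : {set 'F_p}) (l : 'F_p) : {set 'F_p} :=
  [set s - l | s in S].

Definition nonzero_squares (p : nat) : {set 'F_p} :=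
  [set x in nonzero p | [exists y : 'F_p, x == y ^+ 2]].

(* Main.v *)
Require Import Defs.
From HB Require Import structures.
From mathcomp Require Import all_boot all_order all_algebra all_fingroup.
From mathcomp Require Import cyclic finfield ring zify.

Set Implicit Arguments.
Unset Strict Implicit.
Unset Printing Implicit Defensive.

Import GRing.Theory.
Local Open Scope ring_scope.

(** Scale A so that 1 + a b runs over one coset of G: then (1 + a b)^d = nu for
    all a in A and b in B, where d = #|G|, nu = lambda^-d and nu <> 1.  Write
    n = #|A| <= m = #|B|, so that n m = d + n - 1.

    Stepanov's method.  Let c_a be the weights of Lagrange interpolation at 0:
    the sum of c_a phi(a) is phi(0) for deg phi < n.  The polynomial
      f = (sum over a of c_a (1 + a X)^(n m)) - nu
    is nonzero and vanishes to order n at each b in B, because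
    (1 + a b)^(n m) = nu (1 + a b)^(n - 1).  Its degree is at most n m, so the
    cardinality assumption is the extremal case of the resulting bound, and
    f = C P^n with P the product of the X - b (stepanov_is_power).

    Two differential equations.  The Taylor coefficients of f at b of orders
    n, n+1, n+2 are moments of the points a / (1 + a b).  They are computed by
    the recurrence attached to Q, the product of the 1 + a X, and comparing
    them with those of C P^n expresses P''/P' and P'''/P' at the points of B
    through Q, Q', Q'' (deriv2_at_B, deriv3_at_B).  At 0 the coefficients of f
    in degrees 1, ..., n - 1 vanish, hence P' = X^(n-1) R.  Together these give
    a second order equation for P (linear_ode).  Differentiating it and
    eliminating P'' and P''' produces a polynomial W in Q, Q', Q'' alone, of
    degree at most 2n - 2, which P divides (W_dvd).

    Rigidity.  Put W = V P.  At the roots of Q the equation for P and the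
    definition of W together give an equality between X R V and a multiple of
    Q'.  Both have degree less than n = deg Q, so it is an identity
    (quotient_identity).  Its leading coefficients force n = 2, unless a
    certain constant w2 vanishes, and then V = W = 0.  In the latter case, if
    n > 2, all coefficients of Q strictly between the extreme ones vanish.  So
    either Q = 1 + e X^n, or n = 2 and 2 d + 1 = 0 in the field (coset_or_two).
    If Q = 1 + e X^n, then A is a coset of the n-th roots of unity, B is stable
    under these roots and #|A B| <= m < d, which contradicts A B = G - lambda
    (coset_collapse).

    Two elements.  Now p = 2 d + 1, nu = -1, and the equation for P determines
    its coefficients.  The d elements of A B are the roots of (1 + X)^d + 1, so
    this polynomial, suitably scaled, divides P(a1 X) P(a2 X), with a linear
    quotient.  Comparing coefficients up to degree 3 yields 11 = 0
    (eleven_eq0), so p = 11, d = 5 and m = 3. *)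

(** * Interpolation weights and their moments *)

Lemma size_prod_XsubC_set (F : finFieldType) (A : {set F}) :
  size (\prod_(a in A) ('X - a%:P)) = #|A|.+1.
Proof. by rewrite -big_enum size_prod_XsubC -cardE. Qed.

Section Interpolation.
Variable F : finFieldType.
Implicit Types (A : {set F}) (p : {poly F}).

Lemma poly_eq0_on A p :
  (size p <= #|A|)%N -> (forall a, a \in A -> p.[a] = 0) -> p = 0.
Proof.
move=> size_p rootp; apply: (@roots_geq_poly_eq0 _ p (enum A)).
- by apply/allP=> a; rewrite mem_enum => /rootp/eqP.
- exact: enum_uniq.
- by rewrite -cardE.
Qed.

(** The value at 0 of the Lagrange polynomial that is 1 at a and 0 on the rest
    of A. *)
Definition weight A (a : F) : F := \prod_(a' in A :\ a) (a' / (a' - a)).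

Lemma weight_sum A p :
  (size p <= #|A|)%N -> \sum_(a in A) weight A a * p.[a] = p.[0].
Proof.
move=> size_p.
pose ell a : {poly F} :=
  (\prod_(a' in A :\ a) (a - a')^-1) *: \prod_(a' in A :\ a) ('X - a'%:P).
have ellE a x : (ell a).[x] = \prod_(a' in A :\ a) ((x - a') / (a - a')).
  rewrite hornerZ horner_prod big_split /= mulrC; congr (_ * _).
  by apply: eq_bigr => a' _; rewrite hornerXsubC.
have size_ell a : a \in A -> (size (ell a) <= #|A|)%N.
  move=> aA; apply: leq_trans (size_scale_leq _ _) _.
  by rewrite size_prod_XsubC_set (cardsD1 a A) aA.
have ell_eq a : a \in A -> (ell a).[a] = 1.
  move=> aA; rewrite ellE big1 // => a'; rewrite !inE => /andP[a'a _].
  by rewrite divff // subr_eq0 eq_sym.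
have ell_neq a b : b \in A -> b != a -> (ell a).[b] = 0.
  move=> bA ba; rewrite ellE (bigD1 b) ?inE ?ba //=.
  by rewrite subrr !mul0r.
have pE : p = \sum_(a in A) p.[a] *: ell a.
  apply/eqP; rewrite -subr_eq0; apply/eqP; apply: (@poly_eq0_on A).
    apply: leq_trans (size_polyD _ _) _; rewrite geq_max size_p size_polyN.
    apply: leq_trans (size_sum _ _ _) _; apply/bigmax_leqP => a aA.
    exact: leq_trans (size_scale_leq _ _) (size_ell a aA).
  move=> b bA; rewrite !hornerE horner_sum (bigD1 b) //= hornerZ ell_eq //.
  rewrite big1 ?addr0 ?mulr1 ?subrr // => a /andP[aA ab].
  by rewrite hornerZ ell_neq ?mulr0 // eq_sym.
rewrite {2}pE horner_sum; apply: eq_bigr => a _.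
rewrite hornerZ mulrC ellE; congr (_ * _); apply: eq_bigr => a' _.
by rewrite sub0r -[a - a']opprB invrN mulrNN.
Qed.
End Interpolation.

Section WeightedMoments.
Variables (F : finFieldType) (A : {set F}) (c u : F -> F) (K : {poly F}).
Let n := #|A|.
Let S k := \sum_(a in A) c a * u a ^+ k.
Hypothesis size_K : size K = n.+1.
Hypothesis u_neq0 : forall a, a \in A -> u a != 0.
Hypothesis root_K : forall a, a \in A -> K.[- (u a)^-1] = 0.

(** Each - 1 / u_a is a root of K, so the sequence u_a^k satisfies the linear
    recurrence with the alternating coefficients of K; hence so does any fixed
    combination of these sequences. *)
Lemma moment_recurrence k :
  \sum_(j < n.+1) (-1) ^+ j * K`_j * S (n + k - j)%N = 0.
Proof.
under eq_bigr => j _ do rewrite mulr_sumr.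
rewrite exchange_big /= big1 // => a aA.
transitivity (c a * u a ^+ (n + k) * K.[- (u a)^-1]); last first.
  by rewrite root_K // mulr0.
rewrite horner_coef size_K mulr_sumr; apply: eq_bigr => j _.
rewrite expfB_cond; last by rewrite (negPf (u_neq0 aA)) add0n; case: j => j /=; lia.
rewrite -[- (u a)^-1]mulN1r exprMn exprVn; ring.
Qed.

Hypothesis n_gt1 : (1 < n)%N.
Hypothesis S_small : forall j, (j < n)%N -> S j = (j == 0)%:R.

Lemma moment_card_neq0 : S n != 0.
Proof.
have := moment_recurrence 0; rewrite addn0 big_ord_recr /= subnn.
have -> : \sum_(i < n) (-1) ^+ i * K`_i * S (n - i)%N = K`_0 * S n.
  have -> : n = n.-1.+1 by lia.
  rewrite big_ord_recl /= subn0 mul1r big1 ?addr0 // => i _.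
  rewrite /bump /= !add1n S_small; last by case: i => i /=; lia.
  suff -> : (n.-1.+1 - i.+1 == 0)%N = false by rewrite mulr0.
  by case: i => i /=; lia.
rewrite (@S_small 0) ?eqxx; last lia.
apply: contra_eq_neq => ->; rewrite mulr0 !add0r mulr1.
rewrite mulf_neq0 ?expf_neq0 ?oppr_eq0 ?oner_eq0 //.
have := lead_coef_eq0 K; rewrite lead_coefE size_K /= => ->.
by rewrite -size_poly_eq0 size_K.
Qed.

(** The first two terms of the recurrence, isolated: for the next two moments
   the others only involve moments that vanish. *)
Let shifted_sum k : S (n + k) * K`_0 - S (n + k).-1 * K`_1
  + \sum_(j < n.-1) (-1) ^+ j.+2 * K`_j.+2 * S (n + k - j.+2)%N = 0.
Proof.
rewrite -[RHS](moment_recurrence k).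
have -> : n.+1 = n.-1.+2 by lia.
rewrite !big_ord_recl /= subn0 /bump /= !add1n subn1.
rewrite !expr0 !expr1; under [in RHS]eq_bigr => j _ do rewrite !add1n.
by rewrite mul1r mulN1r mulNr addrA [S _ * _]mulrC [S _ * K`_1]mulrC.
Qed.

Lemma moment_card_succ : K`_0 * S n.+1 = K`_1 * S n.
Proof.
have := shifted_sum 1; rewrite addn1 /= big1 ?addr0 => [/eqP|j _].
  by rewrite subr_eq0 => /eqP; rewrite mulrC => ->; rewrite mulrC.
rewrite S_small; last by case: j => j /=; lia.
suff -> : (n.+1 - j.+2 == 0)%N = false by rewrite mulr0.
by case: j => j /=; lia.
Qed.

Lemma moment_card_succ2 : K`_0 * S n.+2 = K`_1 * S n.+1 - K`_2 * S n.
Proof.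
have := shifted_sum 2; rewrite addn2 /=.
have -> : n.-1 = n.-2.+1 by lia.
rewrite big_ord_recl /= big1 => [|j _]; last first.
  rewrite /bump /= !add1n S_small; last by case: j => j /=; lia.
  suff -> : (n.+2 - j.+3 == 0)%N = false by rewrite mulr0.
  by case: j => j /=; lia.
rewrite subSS subSS subn0 addr0 => E.
apply/eqP; rewrite -subr_eq0; apply/eqP; rewrite -[RHS]E; ring.
Qed.
End WeightedMoments.

(** * Coefficients of polynomials *)

Section Taylor.
Variable F : fieldType.
Implicit Types (p q : {poly F}) (b : F).

Definition translate b p : {poly F} := p \Po ('X + b%:P).

Lemma deriv_translate b p : (translate b p)^`() = translate b p^`().
Proof. by rewrite deriv_comp derivD derivX derivC addr0 mulr1. Qed.

Lemma coef0_translate b p : (translate b p)`_0 = p.[b].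
Proof. by rewrite -horner_coef0 horner_comp !hornerE. Qed.

Lemma coef1_translate b p : (translate b p)`_1 = p^`().[b].
Proof.
by rewrite -coef0_translate -deriv_translate coef_deriv mulr1n.
Qed.

Lemma coef2_translate b p : (translate b p)`_2 *+ 2 = p^`()^`().[b].
Proof. by rewrite -coef1_translate -deriv_translate coef_deriv. Qed.

Lemma coef3_translate b p : (translate b p)`_3 *+ 6 = p^`()^`()^`().[b].
Proof.
by rewrite -coef2_translate -deriv_translate coef_deriv -mulrnA.
Qed.

Lemma size_translate b p : size (translate b p) = size p.
Proof. by rewrite size_comp_poly2 // size_XaddC. Qed.

Lemma translateK b p : translate (- b) (translate b p) = p.
Proof. by rewrite /translate polyCN comp_polyXaddC_K. Qed.

(** When j > k the truncated exponent k - j is harmless, the binomial being 0. *)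
Lemma coef_affine_exp (g a : F) k j :
  ((g%:P + a *: 'X) ^+ k)`_j = g ^+ (k - j) * a ^+ j *+ 'C(k, j).
Proof.
rewrite exprDn coef_sum; have [jk|kj] := leqP j k; last first.
  rewrite bin_small // mulr0n big1 // => i _.
  rewrite coefMn -polyC_exp exprZn coefCM coefZ coefXn.
  by rewrite gtn_eqF ?mulr0 ?mul0rn //; case: i => i /=; lia.
rewrite (bigD1 (Ordinal (jk : (j < k.+1)%N))) //= big1 ?addr0 => [|i ij].
  by rewrite coefMn -polyC_exp exprZn coefCM coefZ coefXn eqxx mulr1.
rewrite coefMn -polyC_exp exprZn coefCM coefZ coefXn.
suff -> : (j == i) = false by rewrite !mulr0 mul0rn.
by apply: contraNF ij => /eqP ji; apply/eqP/val_inj.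
Qed.

End Taylor.

(** * The product of the 1 + a X *)

Section LinearProduct.
Variables (F : finFieldType) (A : {set F}).
Hypothesis A0 : 0 \notin A.

Definition linprod : {poly F} := \prod_(a in A) (1 + a *: 'X).

Let A_neq0 a : a \in A -> a != 0.
Proof. by apply: contraTneq => ->. Qed.

Let size_factor a : a \in A -> size (1 + a *: 'X : {poly F}) = 2.
Proof.
move=> aA; rewrite addrC -mul_polyC size_MXaddC.
by rewrite polyC_eq0 (negPf (A_neq0 aA)) /= size_polyC A_neq0.
Qed.

Lemma size_linprod : size linprod = #|A|.+1.
Proof.
rewrite size_prod => [|a aA]; last by rewrite -size_poly_gt0 size_factor.
rewrite (eq_bigr (fun _ => 2)) => [|a aA]; last by rewrite size_factor.
rewrite sum_nat_const.
suff -> : #|fun a : F => a \in A| = #|A| by lia.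
exact: eq_card.
Qed.

Lemma linprod_lead : linprod`_#|A| = \prod_(a in A) a.
Proof.
have -> : linprod`_#|A| = lead_coef linprod by rewrite lead_coefE size_linprod.
rewrite lead_coef_prod; apply: eq_bigr => a aA.
by rewrite lead_coefE size_factor //= coefD coefZ coefX coef1 add0r mulr1.
Qed.

Lemma linprod_0 : linprod`_0 = 1.
Proof.
rewrite -horner_coef0 horner_prod big1 // => a _.
by rewrite !hornerE.
Qed.

Lemma linprod_lead_neq0 : \prod_(a in A) a != 0.
Proof. by apply/prodf_neq0 => a; apply: A_neq0. Qed.

Lemma translate_factor a b :
  translate b (1 + a *: 'X) = (1 + a * b)%:P + a *: 'X :> {poly F}.
Proof.
rewrite /translate comp_polyD comp_polyZ comp_polyX comp_polyC.
by rewrite -!mul_polyC mulrDr polyCD polyCM addrAC addrA.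
Qed.

Lemma linprod_root a : a \in A -> linprod.[- a^-1] = 0.
Proof.
move=> aA; rewrite horner_prod (bigD1 a) //= !hornerE.
by rewrite mulrN divff ?A_neq0 // subrr mul0r.
Qed.

(** The roots of the product are simple. *)
Lemma linprod_deriv_root a : a \in A -> linprod^`().[- a^-1] != 0.
Proof.
move=> aA; rewrite /linprod (bigD1 a) //= derivM hornerD !hornerM.
have -> : (1 + a *: 'X).[- a^-1] = 0 :> F.
  by rewrite !hornerE mulrN divff ?A_neq0 // subrr.
rewrite mul0r addr0 derivD derivZ derivX -[1]/(1%:P) derivC add0r.
rewrite !hornerE mulf_neq0 ?(A_neq0 aA) // horner_prod.
apply/prodf_neq0 => a1 /andP[a1A a1a]; rewrite !hornerE.
apply: contra a1a; rewrite mulrN subr_eq0 => /eqP E.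
by rewrite -(divfK (A_neq0 aA) a1) -E mul1r.
Qed.

Section Moments.
Variable b : F.
Hypothesis g_neq0 : forall a, a \in A -> 1 + a * b != 0.

(** These govern the Taylor coefficients at b of a combination of powers of the
    1 + a X: a / (1 + a b) is the slope of 1 + a X relative to its value at b.  The
    factor (1 + a b)^(n-1) makes the rescaled weights the interpolation weights of
    the new points. *)
Definition moment j :=
  \sum_(a in A) weight A a * (1 + a * b) ^+ #|A|.-1 * (a / (1 + a * b)) ^+ j.

(** The sum applies the interpolation formula to X^j (1 + b X)^(n-1-j), which
    has degree less than n. *)
Lemma moment_small j : (j < #|A|)%N -> moment j = (j == 0)%:R.
Proof.
move=> jn; pose p : {poly F} := 'X^j * (1 + b *: 'X) ^+ (#|A|.-1 - j).
have size_p : (size p <= #|A|)%N.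
  apply: leq_trans (size_polyMleq _ _) _; rewrite size_polyXn addSn /=.
  have := size_poly_exp_leq (1 + b *: 'X : {poly F}) (#|A|.-1 - j).
  have : (size (1 + b *: 'X : {poly F})%R <= 2)%N.
    apply: leq_trans (size_polyD _ _) _; rewrite geq_max size_poly1 /=.
    by apply: leq_trans (size_scale_leq _ _) _; rewrite size_polyX.
  move: (size _) (size _) => s2 s1 s1le s2le.
  have s1k : (s1.-1 * (#|A|.-1 - j) <= #|A|.-1 - j)%N.
    by rewrite -[leqRHS]mul1n leq_mul2r; lia.
  have := leq_trans s2le (_ : _ <= (#|A|.-1 - j).+1)%N; rewrite ltnS => /(_ s1k).
  by move: #|A| jn {s1k s2le} => k; lia.
have := weight_sum size_p; rewrite /moment.
have -> : p.[0] = (j == 0)%:R.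
  by rewrite hornerM hornerXn !hornerE expr0n /= expr1n mulr1.
move=> <-; apply: eq_bigr => a aA; rewrite -mulrA; congr (_ * _).
rewrite hornerM hornerXn horner_exp !hornerE [b * a]mulrC expr_div_n.
have -> : #|A|.-1 = (#|A|.-1 - j + j)%N by lia.
rewrite exprD addnK; field.
by rewrite expf_neq0 // g_neq0.
Qed.

Let u a := a / (1 + a * b).
Let K := translate b linprod.

Let u_neq0 a : a \in A -> u a != 0.
Proof. by move=> aA; apply: mulf_neq0; rewrite ?invr_neq0 ?g_neq0 ?(A_neq0 aA). Qed.

Let root_K a : a \in A -> K.[- (u a)^-1] = 0.
Proof.
move=> aA; rewrite horner_comp -[RHS](linprod_root aA); congr horner.
rewrite !hornerE /u; field.
by rewrite g_neq0 ?A_neq0.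
Qed.

Let size_K : size K = #|A|.+1.
Proof. by rewrite size_translate size_linprod. Qed.

Hypothesis n_gt1 : (1 < #|A|)%N.

Lemma moment_lead_neq0 : moment #|A| != 0.
Proof. exact: (moment_card_neq0 size_K u_neq0 root_K n_gt1 moment_small). Qed.

Lemma moment_next : linprod.[b] * moment #|A|.+1 = linprod^`().[b] * moment #|A|.
Proof.
rewrite -coef0_translate -coef1_translate.
exact: (moment_card_succ size_K u_neq0 root_K n_gt1 moment_small).
Qed.

Lemma moment_next2 :
  2%:R * linprod.[b] ^+ 2 * moment #|A|.+2 =
  (2%:R * linprod^`().[b] ^+ 2 - linprod.[b] * linprod^`()^`().[b]) * moment #|A|.
Proof.
have := moment_card_succ2 size_K u_neq0 root_K n_gt1 moment_small.
have := moment_next; rewrite -coef0_translate -coef1_translate -coef2_translate.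
rewrite -!/(moment _) -/K; set m1 := moment _; set m0 := moment _; set m2 := moment _.
rewrite -(mulr_natl (K`_2)).
move: m1 m0 m2 (K`_0) (K`_1) (K`_2) => {}m1 {}m0 {}m2 k0 k1 k2 E1 E2.
transitivity (2%:R * k0 * (k0 * m2)); first by ring.
rewrite E2; transitivity (2%:R * (k1 * (k0 * m1) - k0 * k2 * m0)); first by ring.
rewrite E1; ring.
Qed.
End Moments.
End LinearProduct.

(** * Divisibility and leading coefficients *)

Lemma prod_XsubC_exp_dvd (F : finFieldType) (B : {set F}) k (p : {poly F}) :
  (forall b, b \in B -> ('X - b%:P) ^+ k %| p) ->
  (\prod_(b in B) ('X - b%:P)) ^+ k %| p.
Proof.
rewrite -big_enum => dvd_p; have := enum_uniq B.
have : {subset enum B <= B} by move=> b; rewrite mem_enum.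
elim: (enum B) => [|b s IHs] sB /=; first by rewrite big_nil expr1n dvd1p.
case/andP=> bs us; rewrite big_cons exprMn Gauss_dvdp.
  rewrite dvd_p ?sB ?mem_head //=.
  by apply: IHs => // x xs; apply: sB; rewrite inE xs orbT.
apply: coprimep_expl; apply: coprimep_expr.
by rewrite coprimep_sym coprimep_XsubC root_prod_XsubC.
Qed.

Section TopCoefs.
Variable F : idomainType.
Implicit Types p q : {poly F}.

Lemma size_deriv_le p k : (size p <= k.+1)%N -> (size p^`() <= k)%N.
Proof. by move=> pk; apply: leq_trans (size_poly _ _) _; lia. Qed.

Lemma coefX_deriv p k : ('X * p^`())`_k = p`_k * k%:R.
Proof. by case: k => [|k]; rewrite coefXM ?mulr0 //= coef_deriv mulr_natr. Qed.

Lemma size_mul_le p q a b :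
  (size p <= a.+1)%N -> (size q <= b.+1)%N -> (size (p * q)%R <= (a + b).+1)%N.
Proof. by move=> pa qb; apply: leq_trans (size_polyMleq _ _) _; lia. Qed.

Lemma coefM_top p q a b :
  (size p <= a.+1)%N -> (size q <= b.+1)%N -> (p * q)`_(a + b) = p`_a * q`_b.
Proof.
move=> pa qb; have ab : (a < (a + b).+1)%N by lia.
rewrite coefM (bigD1 (Ordinal ab)) //= addKn big1 ?addr0 // => i ia.
have {}ia : (i != a :> nat) by [].
have [la|ga|E] := ltngtP i a; last by rewrite E eqxx in ia.
  by rewrite [q`__]nth_default ?mulr0 //; apply: leq_trans qb _; lia.
by rewrite [p`__]nth_default ?mul0r //; apply: leq_trans pa _.
Qed.

End TopCoefs.

Lemma coef_exp_0 (R : comNzRingType) (p : {poly R}) k : (p ^+ k)`_0 = p`_0 ^+ k.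
Proof. by rewrite -!horner_coef0 horner_exp. Qed.

(** The factors p_0 and p_0^2 in this statement and the next avoid the exponents
    k - 1 and k - 2. *)
Lemma coef_exp_1 (R : comNzRingType) (p : {poly R}) k :
  p`_0 * (p ^+ k)`_1 = p`_0 ^+ k * p`_1 *+ k.
Proof.
elim: k => [|k IHk]; first by rewrite coef1 mulr0.
rewrite [p ^+ k.+1]exprS coefM big_ord_recl big_ord1 /= coef_exp_0 mulrDr IHk.
by rewrite mulrSr -mulrnAr exprS; ring.
Qed.

Lemma coef_exp_2 (R : comNzRingType) (p : {poly R}) k :
  2%:R * p`_0 ^+ 2 * (p ^+ k)`_2 =
  p`_0 ^+ k * (2%:R * k%:R * p`_0 * p`_2 + k%:R * (k%:R - 1) * p`_1 ^+ 2).
Proof.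
elim: k => [|k IHk]; first by rewrite coef1 !(mulr0, mul0r) addr0 mulr0.
have -> : (p ^+ k.+1)`_2 = p`_0 * (p ^+ k)`_2 + p`_1 * (p ^+ k)`_1 + p`_2 * (p ^+ k)`_0.
  by rewrite exprS coefM !big_ord_recl big_ord0 addr0 /= /bump /= addrA.
transitivity (p`_0 * (2%:R * p`_0 ^+ 2 * (p ^+ k)`_2) +
  2%:R * p`_1 * p`_0 * (p`_0 * (p ^+ k)`_1) + 2%:R * p`_0 ^+ 2 * p`_2 * (p ^+ k)`_0).
  by ring.
by rewrite IHk coef_exp_1 coef_exp_0 [p`_0 ^+ k.+1]exprS -mulr_natr -!natr1; ring.
Qed.

Lemma coefM_low (R : comNzRingType) (p q : {poly R}) :
  [/\ (p * q)`_0 = p`_0 * q`_0,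
      (p * q)`_1 = p`_0 * q`_1 + p`_1 * q`_0,
      (p * q)`_2 = p`_0 * q`_2 + p`_1 * q`_1 + p`_2 * q`_0
    & (p * q)`_3 = p`_0 * q`_3 + p`_1 * q`_2 + p`_2 * q`_1 + p`_3 * q`_0].
Proof.
by split; rewrite coefM !big_ord_recl big_ord0 /= /bump /= addr0 ?addrA.
Qed.

Lemma coef_comp_scaleX (R : comNzRingType) (p : {poly R}) a j :
  (p \Po (a *: 'X))`_j = p`_j * a ^+ j.
Proof.
rewrite coef_comp_poly; have [jp|pj] := ltnP j (size p); last first.
  rewrite nth_default // mul0r big1 // => i _.
  by rewrite exprZn coefZ coefXn gtn_eqF ?mulr0 //; apply: leq_trans pj.
rewrite (bigD1 (Ordinal jp)) //= exprZn coefZ coefXn eqxx mulr1 big1 ?addr0 // => i ij.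
rewrite exprZn coefZ coefXn; suff /negPf-> : j != i by rewrite !mulr0.
by apply: contraNneq ij => ji; apply/eqP/val_inj.
Qed.

(** * Eliminations in a field *)

(** Here g0, g1, g2 are the Taylor coefficients of P / (X - b), X and x (or y) the
    first and a later coefficient of its n-th power, N is n, u is mu, M and M1 (or M2) the matching
    moments, c0, c1, c2 binomials, and q0, q1, q2 the values of Q, Q', Q''. *)
Lemma elim_deriv2 (F : fieldType) (C X x g0 g1 N M M1 c0 c1 q0 q1 u : F) :
  N != 0 -> M * c0 != 0 ->
  C * X = M * c0 -> C * x = M1 * c1 -> g0 * x = X * g1 * N ->
  (N + 1) * c1 = N * u * c0 -> q0 * M1 = q1 * M ->
  (N + 1) * q0 * (g1 *+ 2) = 2%:R * u * q1 * g0.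
Proof.
move=> N0 M0 E0 E1 EP EB EM; apply: (mulfI N0); apply: (mulfI M0); rewrite -{1}E0.
transitivity (2%:R * (C * (X * g1 * N) * (N + 1) * q0)); first by ring.
rewrite -EP; transitivity (2%:R * ((C * x) * g0 * (N + 1) * q0)); first by ring.
rewrite E1; transitivity (2%:R * (((N + 1) * c1) * (q0 * M1) * g0)); first by ring.
by rewrite EB EM; ring.
Qed.

Lemma elim_deriv3 (F : fieldType)
    (C X y g0 g1 g2 N M M2 c0 c1 c2 q0 q1 q2 u : F) :
  N != 0 -> M * c0 != 0 -> C * X = M * c0 -> C * y = M2 * c2 ->
  2%:R * g0 ^+ 2 * y = X * (2%:R * N * g0 * g2 + N * (N - 1) * g1 ^+ 2) ->
  (N + 1) * c1 = N * u * c0 -> (N + 2%:R) * c2 = (N * u - 1) * c1 ->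
  2%:R * q0 ^+ 2 * M2 = (2%:R * q1 ^+ 2 - q0 * q2) * M ->
  (N + 1) * (N + 2%:R) * q0 ^+ 2 *
    (4%:R * g0 * (g2 *+ 6) + 3%:R * (N - 1) * (g1 *+ 2) ^+ 2) =
  12%:R * u * (N * u - 1) * (2%:R * q1 ^+ 2 - q0 * q2) * g0 ^+ 2.
Proof.
move=> N0 M0 E0 E2 EP EB1 EB2 EM; apply: (mulfI N0); apply: (mulfI M0).
rewrite -{1}E0.
transitivity (12%:R * (C * (X * (2%:R * N * g0 * g2 + N * (N - 1) * g1 ^+ 2))
  * (N + 1) * (N + 2%:R) * q0 ^+ 2)); first by ring.
rewrite -EP; transitivity
  (12%:R * ((C * y) * (2%:R * g0 ^+ 2) * (N + 1) * (N + 2%:R) * q0 ^+ 2)); first by ring.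
rewrite E2; transitivity (12%:R *
  ((N + 1) * ((N + 2%:R) * c2) * (2%:R * q0 ^+ 2 * M2) * g0 ^+ 2)); first by ring.
rewrite EM EB2; transitivity (12%:R * ((N * u - 1) * ((N + 1) * c1)
  * ((2%:R * q1 ^+ 2 - q0 * q2) * M) * g0 ^+ 2)); first by ring.
by rewrite EB1; ring.
Qed.

(** The values p1, p2, p3 of P', P'', P''' at a point are tied by three relations;
    eliminating p2 and p3 leaves 4 u p1^2 times an expression in the values q0, q1,
    q2 of Q, Q', Q'' and in x = b^(n-2). *)
Lemma elim_W (F : fieldType) (N u e q0 q1 q2 p1 p2 p3 x : F) :
  4%:R * u * p1 ^+ 2 != 0 ->
  (N + 1) * q0 * p2 = 2%:R * u * q1 * p1 ->
  (N + 1) * (N + 2%:R) * q0 ^+ 2 * (4%:R * p1 * p3 + 3%:R * (N - 1) * p2 ^+ 2) =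
    12%:R * u * (N * u - 1) * (2%:R * q1 ^+ 2 - q0 * q2) * p1 ^+ 2 ->
  (N + 1) * (q1 * p2 + q0 * p3) - 2%:R * u * (q2 * p1 + q1 * p2) =
    - (N - 1) * (u + 1) * u * e * x * p1 ->
  (N + 1) * (3%:R * N * u + 2%:R * N + 1) * (q0 * q2)
    - (N - 1) * ((3%:R * N + 2%:R) * u + 2%:R * (N + 1)) * (q1 * q1)
    - (N + 2%:R) * (N ^+ 2 - 1) * (u + 1) * e * (x * q0) = 0.
Proof.
move=> c0 H1 H2 H3; apply: (mulfI c0); rewrite mulr0.
have H3' : (N + 1) * q0 * p3 =
    - (N - 1) * (u + 1) * u * e * x * p1 + 2%:R * u * (q2 * p1 + q1 * p2)
      - (N + 1) * q1 * p2 by rewrite -H3; ring.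
pose lhs := (N + 2%:R) * (4%:R * p1 * (N + 1) * q0 * ((N + 1) * q0 * p3)
  + 3%:R * (N - 1) * ((N + 1) * q0 * p2) ^+ 2).
have lhs1 : lhs = (N + 1) *
    (12%:R * u * (N * u - 1) * (2%:R * q1 ^+ 2 - q0 * q2) * p1 ^+ 2).
  by rewrite -H2 /lhs; ring.
have lhs2 : lhs = (N + 2%:R) *
    (4%:R * p1 * (- (N - 1) * (u + 1) * u * e * x * p1 + 2%:R * u * q2 * p1) *
       (N + 1) * q0
     + 4%:R * p1 * (2%:R * u - N - 1) * q1 * (2%:R * u * q1 * p1)
     + 3%:R * (N - 1) * (2%:R * u * q1 * p1) ^+ 2).
  by rewrite -H1 /lhs H3'; ring.
rewrite -[RHS](subrr lhs) {1}lhs2 lhs1; ring.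
Qed.

(** The hypotheses compare the coefficients of degrees 0 to 3 in
    P(a1 X) P(a2 X) = (l0 + l1 X) ((1 + e X)^d + 1) when c1 = d = - 1/2, with
    c2, c3 the next binomials.  They give a1^2 + a2^2 = 4 e and
    (a1 + a2) (a1^3 + a2^3) = 7 e^2, whereas the first makes the left side of the
    second equal to 18 e^2. *)
Lemma elim_eleven (F : fieldType) (a1 a2 p0 p2 p3 l0 l1 c1 c2 c3 : F) :
  3%:R != 0 :> F -> a1 * a2 != 0 -> p0 != 0 ->
  2%:R * c1 = -1 -> 2%:R * c2 = (c1 - 1) * c1 -> 3%:R * c3 = (c1 - 2%:R) * c2 ->
  32%:R * p2 = a1 * a2 * p0 -> 64%:R * p3 = - ((a1 + a2) * (a1 * a2)) * p0 ->
  p0 * p0 = l0 * 2%:R ->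
  l0 * (a1 * a2 * c1) + l1 * 2%:R = 0 ->
  p0 * p2 * (a1 ^+ 2 + a2 ^+ 2) =
    l0 * ((a1 * a2) ^+ 2 * c2) + l1 * (a1 * a2 * c1) ->
  p0 * p3 * (a1 ^+ 3 + a2 ^+ 3) =
    l0 * ((a1 * a2) ^+ 3 * c3) + l1 * ((a1 * a2) ^+ 2 * c2) ->
  11%:R = 0 :> F.
Proof.
set e := a1 * a2 => three0 e0 p00 C1 C2 C3 P2 P3 T0 T1 T2 T3.
have C2' : 8%:R * c2 = 3%:R.
  transitivity (4%:R * (2%:R * c2)); first by ring.
  rewrite C2; transitivity ((2%:R * c1 - 2%:R) * (2%:R * c1)); first by ring.
  by rewrite C1; ring.
have C3' : 16%:R * c3 = - 5%:R.
  apply: (mulfI three0); transitivity (16%:R * (3%:R * c3)); first by ring.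
  rewrite C3; transitivity ((2%:R * c1 - 4%:R) * (8%:R * c2)); first by ring.
  by rewrite C1 C2'; ring.
have L1 : 4%:R * l1 = e * l0.
  transitivity (2%:R * (l0 * (e * c1) + l1 * 2%:R) - l0 * e * (2%:R * c1)).
    by ring.
  by rewrite T1 C1; ring.
have S2 : a1 ^+ 2 + a2 ^+ 2 = 4%:R * e.
  apply: (mulfI e0); apply: (mulfI (mulf_neq0 p00 p00)).
  transitivity (p0 * (e * p0) * (a1 ^+ 2 + a2 ^+ 2)); first by ring.
  rewrite -P2; transitivity (32%:R * (p0 * p2 * (a1 ^+ 2 + a2 ^+ 2))); first by ring.
  rewrite T2; transitivity (4%:R * l0 * e ^+ 2 * (8%:R * c2)
    + 4%:R * (4%:R * l1) * e * (2%:R * c1)); first by ring.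
  by rewrite C2' L1 C1 T0; ring.
have S3 : (a1 + a2) * (a1 ^+ 3 + a2 ^+ 3) = 7%:R * e ^+ 2.
  apply: (mulfI e0); apply: (mulfI (mulf_neq0 p00 p00)).
  transitivity (- (p0 * (- ((a1 + a2) * e) * p0) * (a1 ^+ 3 + a2 ^+ 3))).
    by ring.
  rewrite -P3; transitivity (- (64%:R * (p0 * p3 * (a1 ^+ 3 + a2 ^+ 3)))).
    by ring.
  rewrite T3; transitivity (- (4%:R * l0 * e ^+ 3 * (16%:R * c3)
    + 2%:R * (4%:R * l1) * e ^+ 2 * (8%:R * c2))); first by ring.
  by rewrite C2' C3' L1 T0; ring.
have e20 : e ^+ 2 != 0 by rewrite expf_neq0.
apply: (mulIf e20); rewrite mul0r.
transitivity ((a1 ^+ 2 + a2 ^+ 2 + 2%:R * e) * (a1 ^+ 2 + a2 ^+ 2 - e)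
  - (a1 + a2) * (a1 ^+ 3 + a2 ^+ 3)); last by rewrite /e; ring.
by rewrite S2 S3; ring.
Qed.

(** * The extremal Stepanov polynomial *)

Section Extremal.
Variables (F : finFieldType) (A B : {set F}) (d : nat) (nu : F).
Hypothesis A0 : 0 \notin A.
Hypothesis n_gt1 : (1 < #|A|)%N.
Hypothesis leAB : (#|A| <= #|B|)%N.
Hypothesis extremal : (#|A| * #|B| + 1 = d + #|A|)%N.
Hypothesis nu_neq0 : nu != 0.
Hypothesis nu_neq1 : nu != 1.
Hypothesis power_nu : forall a b, a \in A -> b \in B -> (1 + a * b) ^+ d = nu.
Hypothesis nat_neq0 : forall k, (0 < k <= #|A| * #|B|)%N -> k%:R != 0 :> F.

Let D := (#|A| * #|B|)%N.
Let mu := #|B|.-1.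
Let Q := linprod A.
Let P : {poly F} := \prod_(b in B) ('X - b%:P).

Let d_gt0 : (0 < d)%N.
Proof.
have : (#|A| * 1 <= #|A| * #|B|)%N by rewrite leq_mul2l; lia.
lia.
Qed.

Let AB_neq0 b : b \in B -> forall a, a \in A -> 1 + a * b != 0.
Proof.
move=> bB a aA; apply: contra_neq nu_neq0 => g0.
by rewrite -(power_nu aA bB) g0 expr0n eqn0Ngt d_gt0.
Qed.

Definition stepanov : {poly F} :=
  \sum_(a in A) weight A a *: (1 + a *: 'X) ^+ (#|A| * #|B|) - nu%:P.

(** The values (1 + a b)^d are asked to agree for all a.  This holds at b in B,
    with common value nu, and at b = 0, with common value 1. *)
Lemma stepanov_coef b rho j :
  (forall a, a \in A -> 1 + a * b != 0) ->
  (forall a, a \in A -> (1 + a * b) ^+ d = rho) ->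
  (translate b stepanov)`_j = rho * moment A b j *+ 'C(D, j) - nu *+ (j == 0).
Proof.
move=> g_neq0 g_pow.
have -> : translate b stepanov =
    \sum_(a in A) weight A a *: ((1 + a * b)%:P + a *: 'X) ^+ D - nu%:P.
  rewrite /translate comp_polyB comp_polyC raddf_sum; congr (_ - _).
  apply: eq_bigr => a _ /=; rewrite comp_polyZ rmorphXn /=.
  by rewrite -translate_factor.
rewrite coefB coefC -mulrb coef_sum; congr (_ - _).
rewrite mulr_sumr -sumrMnl; apply: eq_bigr => a aA.
rewrite coefZ coef_affine_exp mulrnAr; case: (leqP j D) => jD; last first.
  by rewrite bin_small.
congr (_ *+ _); rewrite expfB_cond ?(negPf (g_neq0 a aA)) //.
have -> : D = (d + #|A|.-1)%N by rewrite /D; lia.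
rewrite exprD g_pow // expr_div_n; ring.
Qed.

Lemma stepanov_coef_B b j : b \in B ->
  (translate b stepanov)`_j = nu * (moment A b j *+ 'C(D, j) - (j == 0)%:R).
Proof.
move=> bB; rewrite (@stepanov_coef b nu j (AB_neq0 bB)) => [|a aA].
  by rewrite mulrBr mulrnAr mulr_natr.
exact: power_nu.
Qed.

Lemma stepanov_coef_0 j :
  stepanov`_j = moment A 0 j *+ 'C(D, j) - nu *+ (j == 0).
Proof.
have := @stepanov_coef 0 1 j; rewrite mul1r => <-.
- by rewrite /translate addr0 comp_polyXr.
- by move=> a _; rewrite mulr0 addr0 oner_neq0.
- by move=> a _; rewrite mulr0 addr0 expr1n.
Qed.

Lemma stepanov_0 : stepanov`_0 = 1 - nu.
Proof.
rewrite stepanov_coef_0 bin0 moment_small //; last lia.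
by move=> a _; rewrite mulr0 addr0 oner_neq0.
Qed.

Lemma stepanov_small j : (0 < j < #|A|)%N -> stepanov`_j = 0.
Proof.
case/andP=> j0 jn; rewrite stepanov_coef_0 moment_small //; last first.
  by move=> a _; rewrite mulr0 addr0 oner_neq0.
by rewrite eqn0Ngt j0 mul0rn subrr.
Qed.

Lemma size_stepanov : (size stepanov <= D.+1)%N.
Proof.
apply/leq_sizeP => j jD; rewrite stepanov_coef_0 bin_small // mulr0n.
by case: j jD => //= j _; rewrite subrr.
Qed.

Lemma stepanov_dvd b : b \in B -> ('X - b%:P) ^+ #|A| %| stepanov.
Proof.
move=> bB.
have : 'X^#|A| %| translate b stepanov.
  apply/dvdpP; exists (drop_poly #|A| (translate b stepanov)).
  rewrite -[LHS](poly_take_drop #|A|) (_ : take_poly _ _ = 0) ?add0r //.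
  apply/polyP => j; rewrite coef_take_poly coef0; case: ifP => // jn.
  rewrite stepanov_coef_B // moment_small //; last exact: AB_neq0.
  by case: j jn => [|j] _; rewrite ?bin0 ?mul0rn subrr mulr0.
case/dvdpP => q Eq; apply/dvdpP; exists (translate (- b) q).
rewrite -[LHS](translateK b) Eq /translate comp_polyM rmorphXn /=.
by rewrite comp_polyX polyCN.
Qed.

(** The order of vanishing n at the m points of B exhausts the degree n m. *)
Lemma stepanov_is_power : exists2 C, C != 0 & stepanov = C *: P ^+ #|A|.
Proof.
have f_neq0 : stepanov != 0.
  apply: contra_neq nu_neq1 => f0; apply/esym/eqP.
  by rewrite -subr_eq0 -stepanov_0 f0 coef0.
have size_P : size P = #|B|.+1 by rewrite size_prod_XsubC_set.
have dvdf : P ^+ #|A| %| stepanov by apply: prod_XsubC_exp_dvd stepanov_dvd.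
have sizePn : size (P ^+ #|A|) = D.+1.
  rewrite polySpred; first by rewrite size_exp size_P mulnC.
  by apply: expf_neq0; rewrite -size_poly_gt0 size_P.
have : P ^+ #|A| %= stepanov.
  rewrite -dvdp_size_eqp // sizePn eqn_leq size_stepanov andbT.
  by rewrite -sizePn dvdp_leq.
by rewrite eqp_sym => /eqpf_eq.
Qed.

Lemma bin_neq0 j : (j <= D)%N -> 'C(D, j)%:R != 0 :> F.
Proof.
move=> jD; have : (D`!)%:R != 0 :> F.
  rewrite fact_prod natr_prod big_nat_cond prodf_seq_neq0.
  by apply/allP => k _; apply/implyP; rewrite andbT => /nat_neq0.
by rewrite -(bin_fact jD) natrM; apply: contra_neq => ->; rewrite mul0r.
Qed.

Lemma n_neq0 : #|A|%:R != 0 :> F.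
Proof. by apply: nat_neq0; rewrite leq_pmulr //; lia. Qed.

Lemma ltnD : (#|A| + 1 < D)%N.
Proof.
have : (#|A| * 2 <= D)%N by rewrite leq_mul2l; lia.
lia.
Qed.

(** D - n = n mu: the ratio of consecutive binomials at D is n mu / (n + 1). *)
Lemma bin_next : (#|A|%:R + 1) * 'C(D, #|A|.+1)%:R =
  #|A|%:R * mu%:R * 'C(D, #|A|)%:R :> F.
Proof.
rewrite natr1 -!natrM mul_bin_left; congr ((_ * _)%:R).
by rewrite /D /mu -subn1 mulnBr muln1.
Qed.

Lemma bin_next2 : (#|A|%:R + 2%:R) * 'C(D, #|A|.+2)%:R =
  (#|A|%:R * mu%:R - 1) * 'C(D, #|A|.+1)%:R :> F.
Proof.
rewrite -natrD addn2 -natrM mul_bin_left natrM; congr (_ * _).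
rewrite -natrM -[1]/(1%:R) -natrB; last by rewrite /mu muln_gt0; lia.
by congr (_%:R); rewrite /D /mu -!subn1 mulnBr; lia.
Qed.

(** * Taylor expansions at the points of B *)

Section AtB.
Variable b : F.
Hypothesis bB : b \in B.

Let G := \poly_(i < #|B|) (translate b P)`_i.+1.

Let translateP : translate b P = 'X * G.
Proof.
apply/polyP => -[|j]; rewrite coefXM /=.
  rewrite coef0_translate horner_prod (bigD1 b) //=.
  by rewrite hornerXsubC subrr mul0r.
rewrite coef_poly; case: ltnP => // jB.
by rewrite nth_default // size_translate size_prod_XsubC_set.
Qed.

Let G0 : G`_0 = P^`().[b].
Proof. by rewrite -coef1_translate translateP coefXM. Qed.

Let G1 : G`_1 *+ 2 = P^`()^`().[b].
Proof. by rewrite -coef2_translate translateP coefXM. Qed.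

Let G2 : G`_2 *+ 6 = P^`()^`()^`().[b].
Proof. by rewrite -coef3_translate translateP coefXM. Qed.

(** Both sides are coefficients of the translate of the Stepanov polynomial at
    b, from degree n on, divided by nu. *)
Lemma local_coefs : exists2 C, C != 0 & forall k,
  C * (G ^+ #|A|)`_k = moment A b (#|A| + k) *+ 'C(D, #|A| + k).
Proof.
have [C C0 Ef] := stepanov_is_power.
exists (C / nu) => [|k]; first by rewrite mulf_neq0 ?invr_eq0.
have := stepanov_coef_B (#|A| + k) bB.
rewrite addn_eq0 eqn0Ngt (ltn_trans _ n_gt1) //= subr0.
rewrite Ef /translate comp_polyZ rmorphXn /= -/(translate b P) translateP.
rewrite exprMn coefZ coefXnM addKn ltnNge leq_addr /= mulrAC => ->.
by rewrite mulrC mulKf.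
Qed.


Lemma local_deriv_neq0 : P^`().[b] != 0.
Proof.
have [C C0 /(_ 0)] := local_coefs.
rewrite addn0 coef_exp_0 -G0 => E; apply: contraTneq C0 => G00.
have : moment A b #|A| *+ 'C(D, #|A|) == 0.
  by rewrite -E G00 expr0n eqn0Ngt (ltn_trans _ n_gt1) // mulr0.
rewrite -mulr_natr mulf_eq0 (negPf (bin_neq0 _)); last lia.
by rewrite (negPf (moment_lead_neq0 A0 (AB_neq0 bB) n_gt1)).
Qed.

(** Comparison of the coefficients of (X - b)^n and (X - b)^(n+1). *)
Lemma deriv2_at_B :
  (#|A|%:R + 1) * Q.[b] * P^`()^`().[b] = 2%:R * mu%:R * Q^`().[b] * P^`().[b].
Proof.
have [C C0 HC] := local_coefs.
have E0 : C * G`_0 ^+ #|A| = moment A b #|A| * 'C(D, #|A|)%:R.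
  by rewrite mulr_natr -coef_exp_0 -[#|A| in RHS]addn0 -HC.
have E1 : C * (G ^+ #|A|)`_1 = moment A b #|A|.+1 * 'C(D, #|A|.+1)%:R.
  by rewrite mulr_natr HC addn1.
have EP := coef_exp_1 G #|A|; rewrite -mulr_natr in EP.
have EB := bin_next.
have EM := moment_next A0 (AB_neq0 bB) n_gt1; rewrite -/Q in EM.
have M0 : moment A b #|A| * 'C(D, #|A|)%:R != 0.
  apply: mulf_neq0; first exact: moment_lead_neq0 (AB_neq0 bB) n_gt1.
  by apply: bin_neq0; have := ltnD; lia.
by rewrite -G1 -G0; apply: elim_deriv2 n_neq0 M0 E0 E1 EP EB EM.
Qed.

(** The same with (X - b)^(n+2), where the second moment brings in Q''. *)
Lemma deriv3_at_B :
  (#|A|%:R + 1) * (#|A|%:R + 2%:R) * Q.[b] ^+ 2 *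
    (4%:R * P^`().[b] * P^`()^`()^`().[b]
      + 3%:R * (#|A|%:R - 1) * P^`()^`().[b] ^+ 2) =
  12%:R * mu%:R * (#|A|%:R * mu%:R - 1) *
    (2%:R * Q^`().[b] ^+ 2 - Q.[b] * Q^`()^`().[b]) * P^`().[b] ^+ 2.
Proof.
have [C C0 HC] := local_coefs.
have E0 : C * G`_0 ^+ #|A| = moment A b #|A| * 'C(D, #|A|)%:R.
  by rewrite mulr_natr -coef_exp_0 -[#|A| in RHS]addn0 -HC.
have E2 : C * (G ^+ #|A|)`_2 = moment A b #|A|.+2 * 'C(D, #|A|.+2)%:R.
  by rewrite mulr_natr HC addn2.
have EP := coef_exp_2 G #|A|.
have EB := bin_next; have EB2 := bin_next2.
have EM := moment_next2 A0 (AB_neq0 bB) n_gt1; rewrite -/Q in EM.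
have M0 : moment A b #|A| * 'C(D, #|A|)%:R != 0.
  apply: mulf_neq0; first exact: moment_lead_neq0 (AB_neq0 bB) n_gt1.
  by apply: bin_neq0; have := ltnD; lia.
by rewrite -G1 -G2 -G0; apply: elim_deriv3 n_neq0 M0 E0 E2 EP EB EB2 EM.
Qed.

End AtB.

(** * The differential equation for P *)

Let N : F := #|A|%:R.
Let u : F := mu%:R.
Let e := \prod_(a in A) a.
Let s := - (N - 1) * (u + 1) * u * e.

Lemma affine_at0_neq0 a : a \in A -> 1 + a * 0 != 0 :> F.
Proof. by move=> _; rewrite mulr0 addr0 oner_neq0. Qed.

Lemma size_P : size P = #|B|.+1.
Proof. exact: size_prod_XsubC_set. Qed.

Lemma P_root b : b \in B -> P.[b] = 0.
Proof.
by move=> bB; rewrite horner_prod (bigD1 b) //= hornerXsubC subrr mul0r.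
Qed.

Lemma P0_neq0 : P`_0 != 0.
Proof.
have [C _ Ef] := stepanov_is_power.
apply: contra_neq nu_neq1 => P0; apply/esym/eqP; rewrite -subr_eq0 -stepanov_0.
by rewrite Ef coefZ coef_exp_0 P0 expr0n eqn0Ngt (ltn_trans _ n_gt1) // mulr0.
Qed.

Lemma coprime_PX k : coprimep P 'X^k.
Proof.
by apply: coprimep_expr; rewrite coprimepX rootE horner_coef0 P0_neq0.
Qed.

Lemma B_neq0 b : b \in B -> b != 0.
Proof.
move=> bB; apply: contra_neq P0_neq0 => b0.
by rewrite -horner_coef0 -b0 P_root.
Qed.

Lemma deriv_stepanov :
  exists2 C, C != 0 & stepanov^`() = C *: (P ^+ #|A|.-1 * P^`()).
Proof.
have [C C0 Ef] := stepanov_is_power; exists (C * N).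
  by rewrite mulf_neq0 // nat_neq0 // leq_pmulr; lia.
by rewrite Ef derivZ deriv_exp mulrC -scaler_nat scalerA.
Qed.

Definition deriv_cofactor := drop_poly #|A|.-1 P^`().
Let R := deriv_cofactor.

(** The derivative of the Stepanov polynomial, a multiple of P^(n-1) P', is
    divisible by X^(n-1), and P is prime to X. *)
Lemma deriv_P : P^`() = R * 'X^(#|A|.-1).
Proof.
have [C C0 Ef] := deriv_stepanov.
have : 'X^(#|A|.-1) %| C *: (P ^+ #|A|.-1 * P^`()).
  rewrite -Ef; apply/dvdpP; exists (drop_poly #|A|.-1 stepanov^`()).
  rewrite -[LHS](poly_take_drop #|A|.-1) (_ : take_poly _ _ = 0) ?add0r //.
  apply/polyP => j; rewrite coef_take_poly coef0; case: ifP => // jn.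
  by rewrite coef_deriv stepanov_small; [rewrite mul0rn | move: jn; lia].
rewrite dvdpZr // Gauss_dvdpr; last by rewrite coprimep_sym coprimep_expl ?coprime_PX.
by case/dvdpP => q Eq; rewrite /R /deriv_cofactor Eq drop_polyMXn_id.
Qed.

Lemma D_bounds : (#|A| * 2 <= D /\ 2 * #|B| <= D)%N.
Proof.
by split; rewrite /D ?leq_mul2l ?leq_mul2r ?n_gt1 ?(leq_trans n_gt1 leAB) orbT.
Qed.

Lemma N_neq0 : N != 0.
Proof. by exact: n_neq0. Qed.

Lemma N1_neq0 : N + 1 != 0.
Proof. by rewrite /N natr1; apply: nat_neq0; have := D_bounds; lia. Qed.

Lemma N2_neq0 : N + 2%:R != 0.
Proof. by rewrite /N -natrD; apply: nat_neq0; have := D_bounds; lia. Qed.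

Lemma NB1_neq0 : N - 1 != 0.
Proof.
rewrite /N -[1]/(1%:R) -natrB; last lia.
apply: nat_neq0.
by have := D_bounds; lia.
Qed.

Lemma u_neq0 : u != 0.
Proof. by apply: nat_neq0; have := D_bounds; rewrite /mu; lia. Qed.

Lemma u1_neq0 : u + 1 != 0.
Proof. by rewrite /u natr1; apply: nat_neq0; have := D_bounds; rewrite /mu; lia. Qed.

Lemma two_neq0 : 2%:R != 0 :> F.
Proof. by apply: nat_neq0; have := D_bounds; lia. Qed.

Lemma e_neq0 : e != 0.
Proof. exact: linprod_lead_neq0. Qed.

Lemma cardA_pred : #|A|.-1.+1 = #|A|.
Proof. by rewrite prednK //; lia. Qed.

Lemma stepanov_coef_gt0 j : (0 < j)%N -> stepanov`_j = moment A 0 j * 'C(D, j)%:R.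
Proof. by move=> j0; rewrite stepanov_coef_0 eqn0Ngt j0 subr0 mulr_natr. Qed.

Lemma P_coef1 : P`_1 = 0.
Proof.
have : P^`()`_0 = 0.
  rewrite deriv_P coefMXn ifT //.
  by rewrite -subn1 subn_gt0.
by rewrite coef_deriv.
Qed.

Lemma cofactor_0_neq0 : R`_0 != 0.
Proof.
have [C C0 Ef] := deriv_stepanov.
have f_n : stepanov^`()`_#|A|.-1 != 0.
  rewrite coef_deriv cardA_pred -[_ *+ #|A|]mulr_natr stepanov_coef_gt0; last lia.
  apply: mulf_neq0 N_neq0; apply: mulf_neq0.
    exact: moment_lead_neq0 affine_at0_neq0 n_gt1.
  by apply: bin_neq0; have := D_bounds; lia.
apply: contra_neq f_n => R0.
by rewrite Ef deriv_P mulrA coefZ coefMXn ltnn subnn coefM big_ord1 R0 !mulr0.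
Qed.

Lemma Q_coef0 : Q`_0 = 1.
Proof. exact: linprod_0. Qed.

(** P^(n-1) is constant modulo X^2, so R inherits the ratio of two consecutive
    coefficients of the derivative of the Stepanov polynomial. *)
Lemma cofactor_1 : R`_1 = u * Q`_1 * R`_0.
Proof.
have [C C0 Ef] := deriv_stepanov.
have E0 : C * P`_0 ^+ #|A|.-1 * R`_0 = N * (moment A 0 #|A| * 'C(D, #|A|)%:R).
  rewrite -stepanov_coef_gt0; last lia.
  have := congr1 (fun p : {poly F} => p`_#|A|.-1) Ef.
  rewrite /= coef_deriv cardA_pred.
  rewrite deriv_P mulrA coefZ coefMXn ltnn subnn coefM big_ord1 /= coef_exp_0.
  by rewrite mulr_natl => ->; rewrite mulrA.
have E1 : C * P`_0 ^+ #|A|.-1 * R`_1 =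
    (N + 1) * (moment A 0 #|A|.+1 * 'C(D, #|A|.+1)%:R).
  rewrite -stepanov_coef_gt0 //.
  have := congr1 (fun p : {poly F} => p`_#|A|) Ef.
  rewrite /= coef_deriv deriv_P mulrA coefZ coefMXn ltnNge leq_pred /=.
  have -> : (#|A| - #|A|.-1 = 1)%N by lia.
  rewrite coefM big_ord_recl big_ord1 /= /bump /= coef_exp_0.
  have -> : (P ^+ #|A|.-1)`_1 = 0.
    apply: (mulfI P0_neq0); rewrite coef_exp_1 P_coef1 mulr0 mul0rn.
    by rewrite mulr0.
  by rewrite mul0r addr0 subn0 /N natr1 mulr_natl => ->; rewrite mulrA.
have EM := moment_next A0 affine_at0_neq0 n_gt1.
rewrite -!/Q horner_coef0 Q_coef0 mul1r horner_coef0 coef_deriv mulr1n in EM.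
have CP0 : C * P`_0 ^+ #|A|.-1 != 0 by rewrite mulf_neq0 // expf_neq0 // P0_neq0.
apply: (mulfI CP0); rewrite E1 EM.
transitivity (Q`_1 * moment A 0 #|A| * ((N + 1) * 'C(D, #|A|.+1)%:R)); first by ring.
rewrite bin_next -/N -/u.
transitivity (u * Q`_1 * (N * (moment A 0 #|A| * 'C(D, #|A|)%:R))); first by ring.
by rewrite -E0; ring.
Qed.

Lemma deriv2_P : P^`()^`() =
  ('X * R^`() + (N - 1) *: R) * 'X^(#|A|.-2).
Proof.
rewrite deriv_P derivM derivXn -[_ *+ #|A|.-1]mulr_natl.
have -> : #|A|.-1 = #|A|.-2.+1 by lia.
rewrite -mul_polyC /N; have -> : #|A| = #|A|.-2.+2 by lia.
rewrite -[_.+2%:R]natr1 addrK polyC_natr /= exprS; ring.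
Qed.

(** What remains of (n + 1) Q P'' - 2 mu Q' P' after division by X^(n-2). *)
Let L := (N + 1) *: (Q * ('X * R^`() + (N - 1) *: R))
  - (2%:R * u) *: ('X * Q^`() * R).

Lemma linear_ode_factor :
  (N + 1) *: (Q * P^`()^`()) - (2%:R * u) *: (Q^`() * P^`()) = L * 'X^(#|A|.-2).
Proof.
rewrite deriv2_P deriv_P; have -> : #|A|.-1 = #|A|.-2.+1 by lia.
rewrite exprS -!mul_polyC /L -!mul_polyC; ring.
Qed.

Lemma size_Q : size Q = #|A|.+1.
Proof. exact: size_linprod. Qed.

Lemma Q_lead : Q`_#|A| = e.
Proof. exact: linprod_lead. Qed.

Lemma P_lead : P`_#|B| = 1.
Proof.
have := monicP (monic_prod_XsubC (index_enum F) (mem B) id).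
by rewrite lead_coefE -/P size_P.
Qed.

Lemma size_R : (size R <= (#|B| - #|A|).+1)%N.
Proof.
rewrite size_drop_poly; have := size_poly _ _ : (size P^`() <= (size P).-1)%N.
by rewrite size_P; lia.
Qed.

Lemma R_lead : R`_(#|B| - #|A|) = u + 1.
Proof.
rewrite coef_drop_poly; have -> : (#|B| - #|A| + #|A|.-1 = #|B|.-1)%N by lia.
rewrite coef_deriv prednK; last lia.
by rewrite P_lead /u natr1 /mu prednK //; lia.
Qed.

Lemma size_LQ : (size ('X * R^`() + (N - 1) *: R)%R <= (#|B| - #|A|).+1)%N.
Proof.
apply: leq_trans (size_polyD _ _) _; rewrite geq_max; apply/andP; split.
  apply: leq_trans (size_polyMleq _ _) _; rewrite size_polyX add2n.
  exact: size_deriv_le size_R.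
exact: leq_trans (size_scale_leq _ _) size_R.
Qed.

Lemma size_XQ' : (size ('X * Q^`())%R <= #|A|.+1)%N.
Proof.
apply: leq_trans (size_polyMleq _ _) _; rewrite size_polyX add2n.
by apply: size_deriv_le; rewrite size_Q.
Qed.

Lemma addn_subAB : (#|A| + (#|B| - #|A|) = #|B|)%N.
Proof. by rewrite subnKC. Qed.

(** By deriv2_at_B the left side vanishes on B, and it has degree at most m, so it
    is a constant multiple of P; the top coefficients give the constant. *)
Lemma linear_ode : L = s *: P.
Proof.
have dvdPL : P %| L.
  rewrite -[P]expr1; apply: prod_XsubC_exp_dvd => b bB.
  rewrite expr1 dvdp_XsubCl; apply/rootP.
  have b0 : b ^+ #|A|.-2 != 0 by rewrite expf_neq0 // B_neq0.
  apply: (mulIf b0); rewrite mul0r -(hornerXn b) -hornerM -linear_ode_factor.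
  rewrite hornerD hornerN !hornerZ !hornerM !mulrA.
  by rewrite (deriv2_at_B bB) subrr.
have size_L : (size L <= #|B|.+1)%N.
  apply: leq_trans (size_polyD _ _) _; rewrite geq_max size_polyN.
  apply/andP; split; apply: leq_trans (size_scale_leq _ _) _; rewrite -addn_subAB.
    by apply: size_mul_le; rewrite ?size_Q // size_LQ.
  by apply: size_mul_le; rewrite ?size_XQ' ?size_R.
have L_top : L`_#|B| = s.
  rewrite coefB !coefZ -addn_subAB.
  rewrite (coefM_top _ size_LQ) ?size_Q // (coefM_top size_XQ' size_R).
  rewrite coefD coefZ !coefX_deriv Q_lead R_lead natrB // -/N.
  have -> : #|B|%:R = u + 1 :> F by rewrite /u natr1 /mu prednK //; lia.
  rewrite /s; ring.
case/dvdpP: dvdPL => q Eq; have size_q : (size q <= 1)%N.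
  have [->|q0] := eqVneq q 0; first by rewrite size_poly0.
  have P0 : P != 0 by rewrite -size_poly_gt0 size_P.
  by move: size_L; rewrite Eq size_mul // size_P addnS /= -[#|B|.+1]add1n leq_add2r.
have Ec := size1_polyC size_q.
rewrite Eq -L_top Eq Ec mul_polyC coefZ P_lead mulr1.
by rewrite -mul_polyC.
Qed.

Lemma deriv_Q_0 : Q^`()`_0 = Q`_1.
Proof. by rewrite coef_deriv. Qed.

Lemma cofactor_0_eq : (N + 1) * (N - 1) * R`_0 = s * P`_0.
Proof.
rewrite -[RHS]coefZ -linear_ode coefB !coefZ !coef0M coefD coefZ coef0M coefX.
by rewrite Q_coef0 !mul0r mulr0 subr0 mul1r add0r mulrA.
Qed.

(** The coefficient of X in linear_ode, given that of X in P is 0 and that R_1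
    is mu Q_1 R_0. *)
Lemma linear_coef_dichotomy :
  Q`_1 = 0 \/ (N + 2%:R) * u + N + 1 = 0.
Proof.
have : L`_1 = 0 by rewrite linear_ode coefZ P_coef1 mulr0.
rewrite coefB !coefZ -mulrA [(Q * _)`_1]coefM big_ord_recl big_ord1 /= /bump /=.
rewrite !coefD !coefZ !coefXM /= coefM big_ord1 /= deriv_Q_0 coef_deriv mulr1n.
rewrite Q_coef0 cofactor_1 -/R => E.
have : (N - 1) * (R`_0) * (Q`_1 * ((N + 2%:R) * u + N + 1)) = 0.
  by rewrite -[RHS]E; ring.
move/eqP; rewrite mulf_eq0 mulf_eq0 (negPf NB1_neq0) (negPf cofactor_0_neq0) /=.
by rewrite mulf_eq0 => /orP[/eqP|/eqP]; [left | right].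
Qed.

(** * A relation between Q and its derivatives *)

Let w1 := 3%:R * N * u + 2%:R * N + 1.
Let w2 := (3%:R * N + 2%:R) * u + 2%:R * (N + 1).
Let w3 := (N + 2%:R) * (N ^+ 2 - 1) * (u + 1) * e.
Let W := ((N + 1) * w1) *: (Q * Q^`()^`()) - ((N - 1) * w2) *: (Q^`() * Q^`())
  - w3 *: ('X^(#|A|.-2) * Q).

(** At b in B the derivative of linear_ode gives a third relation between P', P''
    and P'''; by elim_W the value of W is then 0. *)
Lemma W_dvd : P %| W.
Proof.
rewrite -[P]expr1; apply: prod_XsubC_exp_dvd => b bB.
rewrite expr1 dvdp_XsubCl; apply/rootP.
have E := congr1 (fun p : {poly F} => p^`().[b]) linear_ode_factor.
rewrite /= linear_ode !derivE !hornerE (P_root bB) mulr0 mul0r addr0 [RHS]mulrAC in E.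
rewrite /W !hornerD !hornerN !hornerZ !hornerM hornerXn.
apply: elim_W (deriv2_at_B bB) (deriv3_at_B bB) E.
rewrite !mulf_neq0 ?u_neq0 ?expf_neq0 ?local_deriv_neq0 //.
by rewrite (natrM F 2 2) mulf_neq0 ?two_neq0.
Qed.

Lemma cardA_pred2 : #|A|.-2.+1 = #|A|.-1.
Proof. lia. Qed.

Lemma size_W : (size W <= (#|A| + #|A|).-2.+1)%N.
Proof.
have sQ' : (size Q^`() <= #|A|.-1.+1)%N by rewrite cardA_pred size_deriv_le ?size_Q.
have sQ'' : (size Q^`()^`() <= #|A|.-2.+1)%N.
  by rewrite cardA_pred2; apply: size_deriv_le.
apply: leq_trans (size_polyD _ _) _; rewrite geq_max size_polyN; apply/andP; split.
  apply: leq_trans (size_polyD _ _) _; rewrite geq_max size_polyN; apply/andP; split.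
    apply: leq_trans (size_scale_leq _ _) _.
    have -> : ((#|A| + #|A|).-2 = #|A| + #|A|.-2)%N by lia.
    by apply: size_mul_le; rewrite ?size_Q.
  apply: leq_trans (size_scale_leq _ _) _.
  have -> : ((#|A| + #|A|).-2 = #|A|.-1 + #|A|.-1)%N by lia.
  by apply: size_mul_le.
apply: leq_trans (size_scale_leq _ _) _.
have -> : ((#|A| + #|A|).-2 = #|A|.-2 + #|A|)%N by lia.
by apply: size_mul_le; rewrite ?size_Q ?size_polyXn.
Qed.

(** The coefficient simplifies to a multiple of w2 by the choice of W. *)
Lemma W_lead : W`_(#|A| + #|A|).-2 = - (N - 1) * w2 * e ^+ 2.
Proof.
have sQ' : (size Q^`() <= #|A|.-1.+1)%N by rewrite cardA_pred size_deriv_le ?size_Q.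
have sQ'' : (size Q^`()^`() <= #|A|.-2.+1)%N.
  by rewrite cardA_pred2; apply: size_deriv_le.
have sQ : (size Q <= #|A|.+1)%N by rewrite size_Q.
have sX : (size ('X^(#|A|.-2) : {poly F}) <= #|A|.-2.+1)%N by rewrite size_polyXn.
have cQ' : Q^`()`_#|A|.-1 = N * e.
  by rewrite coef_deriv cardA_pred Q_lead mulr_natl.
have cQ'' : Q^`()^`()`_#|A|.-2 = N * (N - 1) * e.
  rewrite coef_deriv cardA_pred2 cQ' -mulr_natl -[in LHS]subn1 natrB; last lia.
  by rewrite -/N; ring.
rewrite !coefB !coefZ.
have {1}-> : ((#|A| + #|A|).-2 = #|A| + #|A|.-2)%N by lia.
rewrite (coefM_top sQ sQ'').
have {1}-> : ((#|A| + #|A|).-2 = #|A|.-1 + #|A|.-1)%N by lia.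
rewrite (coefM_top sQ' sQ').
have -> : ((#|A| + #|A|).-2 = #|A|.-2 + #|A|)%N by lia.
rewrite (coefM_top sX sQ) coefXn eqxx Q_lead cQ' cQ''.
by rewrite /w3 /w1 /w2 mul1r; ring.
Qed.

(** At a root x of Q, linear_ode reads - 2 mu x Q' R = s P and the definition of W
    reads - (n-1) w2 Q'^2 = V P; eliminating P and cancelling Q'(x) gives equality
    at the n roots of Q.  The two sides have degree less than n because
    deg R = m - n and deg V <= 2n - 2 - m. *)
Lemma quotient_identity V : W = V * P ->
  2%:R *: ('X * R * V) = (- (N - 1) ^+ 2 * (u + 1) * e * w2) *: Q^`().
Proof.
move=> EV; apply/eqP; rewrite -subr_eq0; apply/eqP.
have card_roots : #|[set - a^-1 | a in A]| = #|A|.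
  by apply: card_imset; apply: inj_comp oppr_inj invr_inj.
apply: (poly_eq0_on (A := [set - a^-1 | a in A])).
  rewrite card_roots; apply: leq_trans (size_polyD _ _) _.
  rewrite geq_max size_polyN; apply/andP; split; last first.
    by apply: leq_trans (size_scale_leq _ _) _; rewrite size_deriv_le ?size_Q.
  apply: leq_trans (size_scale_leq _ _) _.
  have [->|V0] := eqVneq V 0; first by rewrite mulr0 size_poly0.
  have P0 : P != 0 by rewrite -size_poly_gt0 size_P.
  have := size_W; rewrite EV size_mul // size_P => sV.
  have sXR : (size ('X * R)%R <= (#|B| - #|A|).+2)%N.
    by apply: leq_trans (size_polyMleq _ _) _; rewrite size_polyX add2n ltnS size_R.
  apply: leq_trans (size_polyMleq _ _) _.
  by move: (size V) (size _) sV sXR leAB => v w; lia.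
move=> _ /imsetP[a aA ->]; set x := - a^-1.
have x0 : x != 0 by rewrite oppr_eq0 invr_eq0; apply: contraTneq aA => ->.
have Qx : Q.[x] = 0 by apply: linprod_root.
have Q'x : Q^`().[x] != 0 by apply: linprod_deriv_root.
have EL : - (2%:R * u) * (x * Q^`().[x] * R.[x]) = s * P.[x].
  have := congr1 (fun p : {poly F} => p.[x]) linear_ode.
  rewrite /= hornerD hornerN !hornerZ !hornerM Qx hornerX => <-.
  by ring.
have EW : - (N - 1) * w2 * Q^`().[x] ^+ 2 = V.[x] * P.[x].
  have := congr1 (fun p : {poly F} => p.[x]) EV.
  rewrite /= !hornerD !hornerN !hornerZ !hornerM Qx => <-.
  by ring.
rewrite hornerD hornerN !hornerZ !hornerM hornerX; apply: (mulfI u_neq0).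
apply: (mulfI Q'x); rewrite !mulr0.
(* The combination s (- (n-1) w2 Q'^2) - V (- 2 mu x Q' R) vanishes, since both
   terms equal s V P. *)
transitivity (s * (- (N - 1) * w2 * Q^`().[x] ^+ 2)
   - V.[x] * (- (2%:R * u) * (x * Q^`().[x] * R.[x]))
   - 2%:R * 0); last first.
  by rewrite EL EW; ring.
by rewrite /s; ring.
Qed.

Lemma coef_deriv_Q_lead : Q^`()`_#|A|.-1 = N * e.
Proof. by rewrite coef_deriv cardA_pred Q_lead mulr_natl. Qed.

(** If w2 <> 0, comparing leading coefficients in quotient_identity gives
    n (n - 1) = 2, that is (n - 2) (n + 1) = 0. *)
Lemma w2_eq0 : (2 < #|A|)%N -> w2 = 0.
Proof.
move=> n_gt2; apply/eqP; apply: contraTT isT => w2_neq0.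
case/dvdpP: W_dvd => V EV; have Eid := quotient_identity EV.
have := congr1 (fun p : {poly F} => p`_#|A|.-1) Eid.
rewrite /= !coefZ coef_deriv_Q_lead => Etop.
have c_neq0 : (N - 1) * (u + 1) * e ^+ 2 * w2 != 0.
  by rewrite !mulf_neq0 ?expf_neq0 ?NB1_neq0 ?u1_neq0 ?e_neq0.
have V0 : V != 0.
  apply: contra_neq c_neq0 => V0; move: Etop; rewrite V0 mulr0 coef0 mulr0 => Etop.
  apply: (mulfI NB1_neq0); apply: (mulfI N_neq0); rewrite !mulr0 -[RHS]oppr0 Etop.
  by ring.
have P0 : P != 0 by rewrite -size_poly_gt0 size_P.
have sV0 : (0 < size V)%N by rewrite size_poly_gt0.
have := size_W; rewrite EV size_mul // size_P addnS /= => sVP.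
(* k bounds the degree of V, whose coefficient there is the one of W in degree
   2n - 2, as P is monic. *)
have [k Ek] : exists k, (k + #|B| = (#|A| + #|A|).-2)%N.
  exists ((#|A| + #|A|).-2 - #|B|)%N; rewrite subnK //.
  by rewrite -ltnS; apply: leq_trans sVP; rewrite -[leqLHS]add1n leq_add2r.
have sV : (size V <= k.+1)%N by rewrite -(leq_add2r #|B|) addSn Ek.
have VE : V`_k = - (N - 1) * w2 * e ^+ 2.
  by rewrite -W_lead -Ek EV coefM_top ?size_P // P_lead mulr1.
have sXR : (size ('X * R)%R <= (#|B| - #|A|).+2)%N.
  by apply: leq_trans (size_polyMleq _ _) _; rewrite size_polyX add2n ltnS size_R.
have En : #|A|.-1 = ((#|B| - #|A|).+1 + k)%N by move: leAB Ek; lia.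
move: Etop; rewrite En (coefM_top sXR sV) coefXM /= R_lead VE => Etop.
have : (N - 1) * (u + 1) * e ^+ 2 * w2 * ((N - 2%:R) * (N + 1)) = 0.
  transitivity (2%:R * ((u + 1) * (- (N - 1) * w2 * e ^+ 2))
    - (- (N - 1) ^+ 2 * (u + 1) * e * w2 * (N * e))); last by rewrite Etop subrr.
  by ring.
move/eqP; rewrite mulf_eq0 (negPf c_neq0) mulf_eq0 (negPf N1_neq0) orbF /=.
rewrite /N -natrB; last lia.
rewrite (negPf (nat_neq0 _)) //; have := D_bounds.
by move: (D); lia.
Qed.

(** Since w2 = 0, quotient_identity gives V = 0, so W = 0: Q'' is a multiple of
    X^(n-2), which leaves only the coefficient of X.  That one vanishes by
    linear_coef_dichotomy, because w2 and the other alternative together would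
    give (2 - n) mu = 0. *)
Lemma middle_coefs_eq0 j : (2 < #|A|)%N -> (0 < j < #|A|)%N -> Q`_j = 0.
Proof.
move=> n_gt2 jn; have w20 := w2_eq0 n_gt2.
case/dvdpP: W_dvd => V EV.
have V0 : V = 0.
  have := quotient_identity EV; rewrite w20 mulr0 scale0r => /eqP.
  rewrite scaler_eq0 (negPf two_neq0) !mulf_eq0 polyX_eq0 /=.
  suff /negPf-> : R != 0 by move/eqP.
  by apply: contraNneq cofactor_0_neq0 => R0; rewrite R0 coef0.
have Q0 : Q != 0 by rewrite -size_poly_gt0 size_Q.
have EQ : ((N + 1) * w1) *: Q^`()^`() = w3 *: 'X^(#|A|.-2).
  apply: (mulfI Q0); apply/eqP; rewrite -subr_eq0.
  have := EV; rewrite /W V0 mul0r w20 mulr0 scale0r subr0 => <-.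
  by rewrite -!scalerAr [_ * Q]mulrC.
have w3_neq0 : w3 != 0.
  have -> : w3 = (N + 2%:R) * ((N - 1) * (N + 1)) * (u + 1) * e.
    by rewrite /w3; ring.
  by rewrite !mulf_neq0 ?N2_neq0 ?NB1_neq0 ?N1_neq0 ?u1_neq0 ?e_neq0.
have c_neq0 : (N + 1) * w1 != 0.
  apply: contraNneq w3_neq0 => c0.
  have := congr1 (fun p : {poly F} => p`_#|A|.-2) EQ.
  by rewrite /= !coefZ c0 mul0r coefXn eqxx mulr1 => <-.
case: j jn => // -[_|j jn].
  case: linear_coef_dichotomy => // tau0; have := u_neq0.
  have : (N - 2%:R) * u = 0.
    transitivity (w2 - 2%:R * ((N + 2%:R) * u + N + 1)); last first.
      by rewrite w20 tau0 mulr0 subrr.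
    by rewrite /w2; ring.
  move/eqP; rewrite mulf_eq0 => /orP[|->] //.
  rewrite /N -natrB; last lia.
  by rewrite (negPf (nat_neq0 _)) //; have := D_bounds; move: (D); lia.
have := congr1 (fun p : {poly F} => p`_j) EQ.
rewrite /= !coefZ coefXn !coef_deriv.
have -> : (j == #|A|.-2) = false by lia.
rewrite mulr0 => /eqP; rewrite mulf_eq0 (negPf c_neq0) /= -mulrnA.
rewrite -mulr_natr mulf_eq0 natrM mulf_eq0.
have [n1 n2] : j.+1%:R != 0 :> F /\ j.+2%:R != 0 :> F.
  by split; apply: nat_neq0; have := D_bounds; move: (D); lia.
by rewrite (negPf n1) (negPf n2) !orbF => /eqP.
Qed.

Lemma coset_or_two :
  (forall j, (0 < j < #|A|)%N -> Q`_j = 0) \/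
  #|A| = 2 /\ 4%:R * u + 3%:R = 0.
Proof.
have [n_gt2|n_le2] := ltnP 2 #|A|.
  by left=> j; apply: middle_coefs_eq0.
have n2 : #|A| = 2 by lia.
case: linear_coef_dichotomy => [Q1|E]; [left | right].
  by rewrite n2 => -[|[|j]] //.
split=> //; rewrite -[RHS]E /N n2; ring.
Qed.

(** * The two remaining cases *)

(** Now Q = 1 + e X^n, so all elements of A have the same n-th power, the moments
    at 0 vanish in degrees not divisible by n, and the Stepanov polynomial is a
    polynomial in X^n.  Its set of roots B is therefore stable under
    multiplication by a / a'. *)
Lemma coset_collapse a a' b :
  (forall j, (0 < j < #|A|)%N -> Q`_j = 0) ->
  a \in A -> a' \in A -> b \in B -> exists2 b', b' \in B & a * b = a' * b'.
Proof.
move=> Qj aA a'A bB.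
have A_neq0 x : x \in A -> x != 0 by apply: contraTneq => ->.
have root_n x : x \in A -> (- x^-1) ^+ #|A| = - e^-1.
  move=> xA; apply: (mulfI e_neq0); rewrite mulrN divff ?e_neq0 //.
  have := linprod_root A0 xA; rewrite horner_coef -/Q size_Q big_ord_recr /= Q_lead.
  have -> : \sum_(i < #|A|) Q`_i * (- x^-1) ^+ i = 1.
    rewrite -cardA_pred big_ord_recl Q_coef0 mul1r big1 ?addr0 // => i _.
    by rewrite Qj ?mul0r // lift0 /= -ltn_predRL ltn_ord.
  by move/eqP; rewrite addrC addr_eq0 => /eqP.
have pow_n x : x \in A -> x ^+ #|A| = a ^+ #|A|.
  have mul_e y : y \in A -> y ^+ #|A| * - e^-1 = (-1) ^+ #|A|.
    by move=> yA; rewrite -(root_n y yA) -exprMn mulrN divff ?A_neq0.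
  move=> xA; have e'_neq0 : - e^-1 != 0 by rewrite oppr_eq0 invr_eq0 e_neq0.
  by apply: (mulIf e'_neq0); rewrite !mul_e.
have moment_shift j : moment A 0 (#|A| + j) = a ^+ #|A| * moment A 0 j.
  rewrite /moment mulr_sumr; apply: eq_bigr => x xA.
  by rewrite !mulr0 !addr0 !invr1 !mulr1 exprD pow_n // mulrCA.
have moment_eq0 j : ~~ (#|A| %| j)%N -> moment A 0 j = 0.
  rewrite {2}(divn_eq j #|A|) /dvdn => j_neq0.
  elim: (j %/ #|A|)%N => [|k IHk].
    rewrite mul0n add0n moment_small ?(negPf j_neq0) //; first exact: affine_at0_neq0.
    by rewrite ltn_mod; lia.
  by rewrite mulSn -addnA moment_shift IHk mulr0.
pose z := a / a'.
have zn : z ^+ #|A| = 1.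
  by rewrite expr_div_n (pow_n a') // divff // expf_neq0 // A_neq0.
have f_z : stepanov.[z * b] = stepanov.[b].
  rewrite !horner_coef; apply: eq_bigr => i _; rewrite exprMn.
  have [/dvdnP[k ->]|ni] := boolP (#|A| %| i)%N.
    rewrite [z ^+ _](_ : _ = z ^+ (#|A| * k)); last by rewrite mulnC.
    by rewrite exprM zn expr1n mul1r.
  rewrite stepanov_coef_gt0 ?moment_eq0 ?mul0r //.
  by move: ni; case: (nat_of_ord i) => //; rewrite dvdn0.
have [C C0 Ef] := stepanov_is_power.
have : P.[z * b] = 0.
  have : (P ^+ #|A|).[z * b] = 0.
    apply: (mulfI C0); rewrite mulr0 -hornerZ -Ef f_z Ef hornerZ horner_exp (P_root bB).
    by rewrite expr0n -cardA_pred mulr0.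
  by rewrite horner_exp => /eqP; rewrite expf_eq0 => /andP[_ /eqP].
move=> Pzb; exists (z * b); last by rewrite mulrA [a' * _]mulrC divfK // A_neq0.
have := root_prod_XsubC (enum B) (z * b); rewrite mem_enum big_enum /= => <-.
exact/rootP.
Qed.


Lemma small_nat_neq0 k : (0 < k <= 4)%N -> k%:R != 0 :> F.
Proof.
move=> k4; apply: nat_neq0; have := D_bounds; move: k4.
have : (2 * 2 <= D)%N by rewrite leq_mul // (leq_trans n_gt1).
by move: (D) => k'; lia.
Qed.

(** The values of cofactor_0_eq and cofactor_1 with n = 2 and mu = - 3/4. *)
Lemma P_coefs_two : #|A| = 2 -> 4%:R * u + 3%:R = 0 ->
  32%:R * P`_2 = e * P`_0 /\ 64%:R * P`_3 = - (Q`_1 * e) * P`_0.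
Proof.
move=> n2 u34; have N2 : N = 2%:R by rewrite /N n2.
have three_neq0 : 3%:R != 0 :> F by apply: small_nat_neq0.
have ER : P^`() = R * 'X by rewrite deriv_P n2.
have R0 : R`_0 = 2%:R * P`_2.
  by rewrite mulr_natl -coef_deriv ER coefMX.
have R1 : R`_1 = 3%:R * P`_3.
  by rewrite mulr_natl -coef_deriv ER coefMX.
have E0 : 16%:R * R`_0 = e * P`_0.
  apply: (mulfI three_neq0).
  transitivity (16%:R * ((N + 1) * (N - 1) * R`_0)); first by rewrite N2; ring.
  rewrite cofactor_0_eq /s N2.
  (* 16 u (u + 1) = (4 u) (4 u + 4) = - 3. *)
  transitivity (- ((4%:R * u + 3%:R) * (4%:R * u + 1) - 3%:R) * e * P`_0); first by ring.
  by rewrite u34; ring.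
split; first by rewrite -E0 R0; ring.
apply: (mulfI three_neq0).
transitivity (64%:R * R`_1); first by rewrite R1; ring.
rewrite cofactor_1.
transitivity (4%:R * u * Q`_1 * (16%:R * R`_0)); first by ring.
rewrite E0.
transitivity ((4%:R * u + 3%:R) * Q`_1 * (e * P`_0) - 3%:R * (Q`_1 * (e * P`_0))).
  by ring.
by rewrite u34; ring.
Qed.

(** The polynomial (1 + e X)^d + 1 has the d distinct roots y / e for y in A B, and
    if y = a1 b then P(a2 X) vanishes at y / e, and symmetrically; so it divides
    P(a1 X) P(a2 X), whose degree is 2 m = d + 1. *)
Lemma eleven_eq0 : #|A| = 2 -> 4%:R * u + 3%:R = 0 -> nu = -1 ->
  #|[set a * b | a in A, b in B]| = d -> 11%:R = 0 :> F.
Proof.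
move=> n2 u34 nu1 cardAB; have [P2 P3] := P_coefs_two n2 u34.
have /cards2P[a1 [a2 [a12 EA]]] : #|A| == 2 by rewrite n2.
have a1A : a1 \in A by rewrite EA !inE eqxx.
have a2A : a2 \in A by rewrite EA !inE eqxx orbT.
have a1_neq0 : a1 != 0 by apply: contraTneq a1A => ->.
have a2_neq0 : a2 != 0 by apply: contraTneq a2A => ->.
have Ee : e = a1 * a2 by rewrite /e EA big_setU1 ?big_set1 // inE.
have EQ : Q`_1 = a1 + a2.
  rewrite /Q /linprod EA big_setU1 ?big_set1 ?inE //=.
  rewrite coefM big_ord_recl big_ord1 /= !coefD !coefZ !coefX !coef1 /=.
  by ring.
(* Since n = 2, d = 2 mu + 1 and 4 mu = - 3. *)
have du : 2%:R * d%:R = -1 :> F.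
  have -> : d = (2 * mu + 1)%N by move: extremal; rewrite /mu n2; lia.
  rewrite natrD natrM -/u.
  by apply/eqP; rewrite -subr_eq0 -[X in _ == X]u34; apply/eqP; ring.
pose T : {poly F} := (P \Po (a1 *: 'X)) * (P \Po (a2 *: 'X)).
pose Psi : {poly F} := (1%:P + e *: 'X) ^+ d - nu%:P.
have Psi_coef j : Psi`_j = e ^+ j * 'C(d, j)%:R - nu *+ (j == 0).
  by rewrite coefB coef_affine_exp expr1n mul1r coefC -mulrb mulr_natr.
have size_Psi : size Psi = d.+1.
  apply/eqP; rewrite eqn_leq; apply/andP; split.
    apply/leq_sizeP => j jd; rewrite Psi_coef bin_small // mulr0 sub0r.
    by rewrite gtn_eqF ?mulr0n ?oppr0 //; apply: leq_trans jd.
  rewrite ltnNge; apply: contraL isT => /leq_sizeP/(_ d (leqnn d)).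
  rewrite Psi_coef binn mulr1 gtn_eqF ?d_gt0 // subr0 => /eqP.
  by rewrite expf_eq0 (negPf e_neq0) andbF.
pose AB := [set a * b | a in A, b in B]; pose Z := [set y / e | y in AB].
have size_T : size T = d.+2.
  have size_scale a : a != 0 -> size (a *: 'X : {poly F}) = 2.
    by move=> a_neq0; rewrite size_scale // size_polyX.
  have P0 : P != 0 by rewrite -size_poly_gt0 size_P.
  rewrite size_mul ?comp_poly2_eq0 ?size_scale // !size_comp_poly2 ?size_scale //.
  by rewrite size_P; move: extremal; rewrite n2; move: #|B| => k; lia.
have dvdT : Psi %| T.
  have Psi_roots : all (root Psi) (enum Z).
    apply/allP => z; rewrite mem_enum => /imsetP[_ /imset2P[a b aA bB ->] ->].
    rewrite /root hornerD hornerN hornerC horner_exp hornerD hornerZ hornerC hornerX.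
    by rewrite mulrC divfK ?e_neq0 // power_nu // subrr.
  have cardZ : #|Z| = d.
    by rewrite card_imset //; apply: mulIf; rewrite invr_eq0 e_neq0.
  rewrite (all_roots_prod_XsubC _ Psi_roots) -?cardE ?cardZ //; last first.
    by rewrite uniq_rootsE enum_uniq.
  rewrite dvdpZl ?lead_coef_eq0 -?size_poly_gt0 ?size_Psi // big_enum /=.
  rewrite -[\prod_(_ in _) _]expr1; apply: prod_XsubC_exp_dvd => z.
  rewrite expr1 dvdp_XsubCl => /imsetP[_ /imset2P[a b aA bB ->] ->].
  rewrite /root hornerM !horner_comp !hornerZ hornerX Ee.
  have [->|->] : a = a1 \/ a = a2.
    by move: aA; rewrite EA !inE => /orP[]/eqP; [left|right].
    have -> : a2 * (a1 * b / (a1 * a2)) = b by field; rewrite a1_neq0 a2_neq0.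
    by rewrite (P_root bB) mulr0.
  have -> : a1 * (a2 * b / (a1 * a2)) = b by field; rewrite a1_neq0 a2_neq0.
  by rewrite (P_root bB) mul0r.
case/dvdpP: dvdT => L' ET.
have T0 : T != 0 by rewrite -size_poly_gt0 size_T.
have size_L' : (size L' <= 2)%N.
  have L'0 : L' != 0 by apply: contraNneq T0 => L0; rewrite ET L0 mul0r.
  have Psi0 : Psi != 0 by rewrite -size_poly_gt0 size_Psi.
  move: size_T; rewrite ET size_mul // size_Psi addnS /= -[d.+2]/(2 + d)%N.
  by move/addIn ->.
have L_coef j : (1 < j)%N -> L'`_j = 0.
  by move=> j1; rewrite nth_default //; apply: leq_trans j1.
have T_0 : T`_0 = P`_0 * P`_0.
  by case: (coefM_low (P \Po (a1 *: 'X)) (P \Po (a2 *: 'X))) => [-> _ _ _];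
     rewrite !coef_comp_scaleX; ring.
have T_1 : T`_1 = 0.
  by case: (coefM_low (P \Po (a1 *: 'X)) (P \Po (a2 *: 'X))) => [_ -> _ _];
     rewrite !coef_comp_scaleX P_coef1; ring.
have T_2 : T`_2 = P`_0 * P`_2 * (a1 ^+ 2 + a2 ^+ 2).
  by case: (coefM_low (P \Po (a1 *: 'X)) (P \Po (a2 *: 'X))) => [_ _ -> _];
     rewrite !coef_comp_scaleX P_coef1; ring.
have T_3 : T`_3 = P`_0 * P`_3 * (a1 ^+ 3 + a2 ^+ 3).
  by case: (coefM_low (P \Po (a1 *: 'X)) (P \Po (a2 *: 'X))) => [_ _ _ ->];
     rewrite !coef_comp_scaleX P_coef1; ring.
have [LT0 LT1 LT2 LT3] := coefM_low L' Psi.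
have [Psi_0 Psi_1 Psi_2 Psi_3] : [/\ Psi`_0 = 2%:R, Psi`_1 = e * d%:R,
    Psi`_2 = e ^+ 2 * 'C(d, 2)%:R & Psi`_3 = e ^+ 3 * 'C(d, 3)%:R].
  by rewrite !Psi_coef nu1 bin0 bin1 /=; split; ring.
rewrite -ET Psi_0 in LT0; rewrite -ET Psi_0 Psi_1 in LT1.
rewrite -ET (L_coef 2) // Psi_0 Psi_1 Psi_2 in LT2.
rewrite -ET (L_coef 2) // (L_coef 3) // Psi_0 Psi_1 Psi_2 Psi_3 in LT3.
have bin2E : 2%:R * 'C(d, 2)%:R = (d%:R - 1) * d%:R :> F.
  by rewrite -natrM mul_bin_left bin1 natrM natrB.
have bin3E : 3%:R * 'C(d, 3)%:R = (d%:R - 2%:R) * 'C(d, 2)%:R :> F.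
  rewrite -natrM mul_bin_left natrM natrB //.
  by move: extremal leAB; rewrite n2; lia.
apply: (@elim_eleven F a1 a2 P`_0 P`_2 P`_3 L'`_0 L'`_1 d%:R 'C(d, 2)%:R 'C(d, 3)%:R)
  => //.
- exact: small_nat_neq0.
- by rewrite mulf_neq0.
- exact: P0_neq0.
- by rewrite P2 Ee.
- by rewrite P3 EQ Ee.
- by rewrite -T_0 LT0; ring.
- by rewrite -Ee -[RHS]T_1 LT1; ring.
- by rewrite -Ee -T_2 LT2; ring.
- by rewrite -Ee -T_3 LT3; ring.
Qed.


Let AB := [set a * b | a in A, b in B].

(** The coset case is excluded by size: all products would lie in a single
    multiple of B, while m < d. *)
Lemma extremal_two : #|AB| = d -> #|A| = 2 /\ (2 * d + 1)%:R = 0 :> F.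
Proof.
move=> cardAB; case: coset_or_two => [coset | [n2 u34]]; last first.
  split=> //; have -> : (2 * d + 1 = 4 * mu + 3)%N by move: extremal; rewrite /mu n2; lia.
  by rewrite natrD natrM.
have [a aA] : exists a, a \in A by apply/card_gt0P; lia.
pose aB := [set a * b | b in B].
have : (#|AB| <= #|aB|)%N.
  apply: subset_leq_card; apply/subsetP => _ /imset2P[a1 b a1A bB ->].
  have [b' b'B ->] := coset_collapse coset a1A aA bB.
  exact: imset_f.
have : (#|aB| <= #|B|)%N by apply: leq_imset_card.
have := D_bounds; rewrite cardAB; move: extremal leAB n_gt1; rewrite -/D.
by move: D (#|A|) (#|B|) (#|aB|) => k n m c; lia.
Qed.

End Extremal.

(** * Multiplicative subgroups of a prime field *)

Section Subgroups.
Variables (p : nat) (p_prime : prime p) (G : {group {unit 'F_p}}).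

Lemma card_elements : #|elements G| = #|G|.
Proof. by rewrite card_imset //; apply: val_inj. Qed.

Lemma elements_power x : (x \in elements G) = (x ^+ #|G| == 1).
Proof.
have sub : elements G \subset [set x | x ^+ #|G| == 1].
  apply/subsetP => _ /imsetP[u uG ->]; rewrite inE -FinRing.val_unitX.
  by rewrite expg_cardG.
suff -> : elements G = [set x | x ^+ #|G| == 1] by rewrite inE.
apply/eqP; rewrite eqEcard sub /= card_elements [leqLHS]cardE.
apply: max_unity_roots; rewrite ?enum_uniq ?cardG_gt0 //.
by apply/allP => y; rewrite mem_enum inE unity_rootE.
Qed.

Lemma proper_subgroup_card : G \proper [set: {unit 'F_p}] ->
  (2 * #|G| < p)%N /\ (#|G| %| p.-1)%N.
Proof.
move=> Gp; have card_units : #|[set: {unit 'F_p}]| = p.-1.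
  by rewrite card_finField_unit card_Fp.
have := proper_card Gp; have := cardSg (proper_sub Gp).
rewrite card_units => dG ltG; split=> //.
case/dvdnP: dG ltG => -[|[|k]] E; rewrite E ?mul0n ?mul1n ?ltnn ?ltn0 //.
have := prime_gt0 p_prime; have : (2 * #|G| <= k.+2 * #|G|)%N by rewrite leq_mul2r orbT.
by rewrite -E => *; lia.
Qed.

Lemma nat_Fp_eq0 k : (k%:R == 0 :> 'F_p) = (p %| k)%N.
Proof. by rewrite (dvdn_pcharf (pchar_Fp p_prime)). Qed.

Lemma Fermat_little (x : 'F_p) : x != 0 -> x ^+ p.-1 = 1.
Proof.
move=> x0; apply: (mulfI x0); rewrite -exprS prednK ?prime_gt0 // mulr1.
by rewrite -[X in _ ^+ X](card_Fp p_prime) expf_card.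
Qed.

End Subgroups.

(** The configuration studied above, with A divided by l: 1 + (a / l) b is then
    g / l for some g in G, so nu is the d-th power of 1 / l, and nu <> 1 since l is
    not in G. *)
Lemma ordered_case (p : nat) (G : {group {unit 'F_p}}) (l : 'F_p) (A B : {set 'F_p}) :
  prime p -> G \proper [set: {unit 'F_p}] -> l \in nonzero p :\: elements G ->
  A \subset nonzero p -> (2 <= #|A| <= #|B|)%N ->
  prodset A B = translate_sub (elements G) l ->
  (#|A| * #|B| = #|G| + #|A| - 1)%N ->
  [/\ p = 11%N, elements G = nonzero_squares p, #|A| = 2 & #|B| = 3].
Proof.
move=> p_prime G_proper; rewrite !inE => /andP[lG l_neq0] A_neq0 /andP[n_gt1 leAB].
move=> ABG cardAB; have [d_lt d_dvd] := proper_subgroup_card p_prime G_proper.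
set d := #|G| in cardAB d_lt d_dvd *.
pose A' := [set a / l | a in A]; pose nu := l^-1 ^+ d.
have cardA' : #|A'| = #|A|.
  by rewrite card_imset //; apply: mulIf; rewrite invr_eq0.
have A'0 : 0 \notin A'.
  apply/imsetP => -[a aA /esym/eqP]; rewrite mulf_eq0 invr_eq0 (negPf l_neq0) orbF.
  by have := subsetP A_neq0 a aA; rewrite inE => /negPf->.
have extremal : (#|A'| * #|B| + 1 = d + #|A'|)%N by rewrite cardA'; lia.
have nu_neq0 : nu != 0 by rewrite expf_neq0 // invr_eq0.
have nu_neq1 : nu != 1.
  apply: contra lG => /eqP nu1; rewrite elements_power // -/d.
  by rewrite -invr_eq1 -exprVn -/nu nu1.
have power_nu a b : a \in A' -> b \in B -> (1 + a * b) ^+ d = nu.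
  case/imsetP=> a1 a1A -> bB.
  have : a1 * b \in translate_sub (elements G) l by rewrite -ABG imset2_f.
  case/imsetP=> g gG Eg.
  have -> : 1 + a1 / l * b = g / l by rewrite mulrAC Eg; field.
  by move: gG; rewrite elements_power // exprMn -/d => /eqP->; rewrite mul1r.
have nat_neq0 k : (0 < k <= #|A'| * #|B|)%N -> k%:R != 0 :> 'F_p.
  rewrite cardA' cardAB nat_Fp_eq0 // => /andP[k0 kle].
  rewrite gtnNdvd //; apply: leq_ltn_trans d_lt; apply: leq_trans kle _.
  have : (#|A| * 2 <= #|A| * #|B|)%N by rewrite leq_mul2l (leq_trans n_gt1 leAB) orbT.
  lia.
rewrite -cardA' in n_gt1 leAB.
have cardA'B : #|[set a * b | a in A', b in B]| = d.
  have -> : d = #|prodset A B|.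
    rewrite ABG card_imset; last exact: addIr.
    by rewrite card_elements.
  have l'_neq0 : l^-1 != 0 by rewrite invr_eq0.
  rewrite -(card_imset (prodset A B) (mulIf l'_neq0)).
  congr #|pred_of_set _|; apply/setP => x; apply/imset2P/imsetP.
    case=> _ b /imsetP[a aA ->] bB ->; exists (a * b); first exact: imset2_f.
    by rewrite mulrAC.
  case=> _ /imset2P[a b aA bB ->] ->; exists (a / l) b => //; first exact: imset_f.
  by rewrite mulrAC.
have [n2 d2] := extremal_two A'0 n_gt1 leAB extremal nu_neq0 nu_neq1 power_nu
  nat_neq0 cardA'B.
(* p divides 2 d + 1, and 2 d < p as G is proper. *)
have pE : p = (2 * d + 1)%N.
  apply/eqP; rewrite eqn_leq; apply/andP; split; last by lia.
  by apply: dvdn_leq; [lia | rewrite -nat_Fp_eq0 // d2].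
have u34 : 4%:R * #|B|.-1%:R + 3%:R = 0 :> 'F_p.
  by rewrite -d2 -natrM -natrD; congr (_%:R); move: extremal; rewrite n2; lia.
(* The square of nu is 1 because p - 1 = 2 d. *)
have nu_opp : nu = -1.
  have : nu ^+ 2 == 1.
    have Ed : (d * 2 = p.-1)%N by lia.
    by rewrite -exprM Ed Fermat_little // invr_eq0.
  by rewrite sqrf_eq1 (negPf nu_neq1) => /eqP.
have p11 : p = 11.
  have := eleven_eq0 A'0 n_gt1 leAB extremal nu_neq0 nu_neq1 power_nu nat_neq0
    n2 u34 nu_opp cardA'B.
  by move/eqP; rewrite nat_Fp_eq0 // dvdn_prime2 // => /eqP.
have d5 : d = 5 by lia.
split=> //; last 2 first.
- by rewrite -cardA'.
- by move: extremal; rewrite n2 d5; lia.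
apply/setP => x; rewrite elements_power // -/d d5 !inE.
apply/eqP/andP => [x5 | [x0 /existsP[y /eqP Ex]]].
  have x_neq0 : x != 0.
    by apply: contraPneq x5 => ->; rewrite expr0n /= => /esym/eqP; rewrite oner_eq0.
  by split=> //; apply/existsP; exists (x ^+ 3); rewrite -exprM (exprD x 1 5) x5 mulr1.
have y_neq0 : y != 0 by apply: contraNneq x0 => y0; rewrite Ex y0 expr0n.
have E10 : (2 * 5)%N = p.-1 by rewrite p11.
rewrite Ex -exprM E10.
exact: Fermat_little.
Qed.

Theorem theorem1p5 (p : nat) (p_prime : prime p) (p_odd : odd p)
    (G : {group {unit 'F_p}}) (G_proper : G \proper [set: {unit 'F_p}])
    (l : 'F_p) (l_in : l \in nonzero p :\: elements G) :
  (forall A B : {set 'F_p},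
      A \subset nonzero p -> B \subset nonzero p ->
      (2 <= #|A|)%N -> (2 <= #|B|)%N ->
      prodset A B = translate_sub (elements G) l ->
      (#|A| * #|B| = #|G| + minn #|A| #|B| - 1)%N ->
      [/\ p = 11%N,
          elements G = nonzero_squares p
        & [:: #|A|; #|B|] =i [:: 2%N; 3%N]]) /\
  (p <> 11%N ->
    ~ exists A B : {set 'F_p},
        [/\ A \subset nonzero p /\ B \subset nonzero p,
            (2 <= #|A|)%N /\ (2 <= #|B|)%N,
            (#|A| * #|B| = #|G| + minn #|A| #|B| - 1)%N
          & prodset A B = translate_sub (elements G) l]).
Proof.
have main (A B : {set 'F_p}) : A \subset nonzero p -> B \subset nonzero p ->
    (2 <= #|A|)%N -> (2 <= #|B|)%N ->
    prodset A B = translate_sub (elements G) l ->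
    (#|A| * #|B| = #|G| + minn #|A| #|B| - 1)%N ->
    [/\ p = 11%N, elements G = nonzero_squares p & [:: #|A|; #|B|] =i [:: 2%N; 3%N]].
  move=> A0 B0 A2 B2 ABG cardAB; have [leAB | ltBA] := leqP #|A| #|B|.
    have [] := ordered_case p_prime G_proper l_in A0 _ ABG _.
    - by rewrite A2 leAB.
    - by rewrite cardAB (minn_idPl leAB).
    by move=> p11 EG -> ->.
  have prodC : prodset B A = prodset A B.
    apply/setP => x; apply/imset2P/imset2P => -[a b aA bB ->];
      by exists b a => //; rewrite mulrC.
  have [] := ordered_case (A := B) (B := A) p_prime G_proper l_in B0.
  - by rewrite B2 ltnW.
  - by rewrite prodC.
  - by rewrite mulnC cardAB (minn_idPr (ltnW ltBA)).
  move=> p11 EG -> ->; split=> // x; rewrite !inE.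
  by rewrite orbC.
split=> // p11 [A [B [[A0 B0] [A2 B2] cardAB ABG]]].
by have [] := main A B A0 B0 A2 B2 ABG cardAB.
Qed.
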